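(* Let a random open system with a decreasing sequence of random holes $H_{\omega,\epsilon_N}$, $N\ge1$, be as in the context, and assume (C1'), (C2), (C3), (C4'), (C5'), (C7'), (C8) and (S). For each $\omega$ and $N$ let $\mathcal H_{\omega,N}=\{H_{\sigma^j\omega,\epsilon_N}\}_{j\ge0}$ and define the first random hitting time $$\tau_{\omega,\mathcal H_{\omega,N}}(x)=\inf\{k\ge1:T_\omega^k(x)\in H_{\sigma^k\omega,\epsilon_N}\}.$$ Then for $m$-a.e. $\omega\in\Omega$ $$\lim_{N\to\infty}\mu_{\omega,0}\big(\tau_{\omega,\mathcal H_{\omega,N}}\,\mu_{\omega,0}(H_{\omega,\epsilon_N})>t_\omega\big)=\exp\Big(-\int_\Omega t_\omega\theta_{\omega,0}\,dm(\omega)\Big),$$ where $\theta_{\omega,0}=1-\sum_{k=0}^\infty\hat q_{\omega,0}^{(k)}$.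
   Context: **Closed system.** $(\Omega,\mathscr F,m)$ is a probability space, $\sigma:\Omega\to\Omega$ invertible, ergodic, $m$-preserving. $X$ is a complete metrisable space with Borel $\sigma$-algebra $\mathscr B$; $\omega\mapsto\mathcal J_{\omega,0}\subseteq X$ is a closed random set (closed-valued and measurable); $T_\omega:\mathcal J_{\omega,0}\to\mathcal J_{\sigma\omega,0}$, $T_\omega^n=T_{\sigma^{n-1}\omega}\circ\dots\circ T_\omega$; $\mathcal J_0=\bigcup_\omega\{\omega\}\times\mathcal J_{\omega,0}$, and $T(\omega,x)=(\sigma\omega,T_\omega x)$ is measurable on $\mathcal J_0$. A random (probability) measure on $\mathcal J_0$ is a measure with marginal $m$ on $\Omega$, identified with its disintegration into fibre (probability) measures. $\mathcal B_\omega\subseteq L^\infty(\nu_{\omega,0})$ ($\nu_{\omega,0}$ below) is a Banach space of real functions on $\mathcal J_{\omega,0}$; $\|\cdot\|_{\infty,\omega}$ is the $L^\infty(\nu_{\omega,0})$ norm; $\mathcal B$ is the set of $f:\mathcal J_0\to\mathbb R$ with $f_\omega=f(\omega,\cdot)\in\mathcal B_\omega$ for all $\omega$. For a potential $\varphi_0:\mathcal J_0\to\mathbb R$ with $g_{\omega,0}=e^{\varphi_{\omega,0}}\in\mathcal B_\omega$, the transfer operator $\mathcal L_{\omega,0}f(x)=\sum_{y\in T_\omega^{-1}(x)}f(y)g_{\omega,0}(y)$ is well defined $\mathcal B_\omega\to\mathcal B_{\sigma\omega}$, and $(\omega,x)\mapsto\mathcal L_{\sigma^{-1}\omega,0}f_{\sigma^{-1}\omega}(x)$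 is measurable for measurable $f\in\mathcal B$. There are a random probability measure $\nu_0=\{\nu_{\omega,0}\}$ on $\mathcal J_0$ with non-atomic fibres, measurable $\lambda_0:\Omega\to\mathbb R\setminus\{0\}$ and measurable $\phi_0\in\mathcal B$, $\phi_0>0$, with $\mathcal L_{\omega,0}\phi_{\omega,0}=\lambda_{\omega,0}\phi_{\sigma\omega,0}$, $\nu_{\sigma\omega,0}(\mathcal L_{\omega,0}f)=\lambda_{\omega,0}\nu_{\omega,0}(f)$ for $f\in\mathcal B_\omega$, $\lambda_{\omega,0}=\nu_{\sigma\omega,0}(\mathcal L_{\omega,0}\mathbf 1)$, $\log\lambda_{\omega,0}\in L^1(m)$; $\mu_{\omega,0}:=\phi_{\omega,0}\nu_{\omega,0}$ defines a $T$-invariant random probability measure $\mu_0$. **Holes and open systems.** $(H_{\omega,\epsilon_N})_{N\ge1}$ is a decreasing sequence of holes arising as $H_{\omega,\epsilon_N}=\{x\in\mathcal J_{\omega,0}:h_\omega(x)>z_{\omega,N}\}$ for continuous $h_\omega:\mathcal J_{\omega,0}\to\mathbb R$ and an increasing sequence $(z_{\omega,N})_N$ of thresholds lying between the $\nu_{\omega,0}$-essential infimum $\underline z_\omega$ and essential supremum $\overline z_\omega$ of $h_\omega$, with $\underline z_\omega<\overline z_\omega$ for $m$-a.e. $\omega$ and $\nu_{\omega,0}(\{h_\omega>\overline z_\omega\})=0$; $\epsilon_N$ is merely an index label. Below, $\epsilon$ ranges over $\{0\}\cup\{\epsilon_N:N\ge1\}$, ''$\epsilon\to0$'' means $N\to\infty$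 and ''$\epsilon>0$ sufficiently small'' means $N$ sufficiently large. $H_\epsilon=\bigcup_\omega\{\omega\}\times H_{\omega,\epsilon}\subseteq\mathcal J_0$ is measurable, $0<\nu_0(H_\epsilon)<1$; $\mathcal J_{\omega,\epsilon}=\mathcal J_{\omega,0}\setminus H_{\omega,\epsilon}$, $X_{\omega,\infty,\epsilon}=\{x\in\mathcal J_{\omega,0}:T_\omega^jx\notin H_{\sigma^j\omega,\epsilon}\ \forall j\ge0\}$. $\mathcal L_{\omega,\epsilon}f=\mathcal L_{\omega,0}(\mathbf 1_{\mathcal J_{\omega,\epsilon}}f)$ maps $\mathcal B_\omega$ to $\mathcal B_{\sigma\omega}$; $\mathcal L^n_{\omega,\epsilon}$, $Q^n_{\omega,\epsilon}$ denote compositions along the $\sigma$-orbit. For $m$-a.e. $\omega$, $X_{\omega,\infty,\epsilon}\neq\emptyset$ and $\bigcap_n\{x:\mathcal L^n_{\sigma^{-n}\omega,\epsilon}\mathbf 1(x)\ne0\}\neq\emptyset$. $\Omega_+$ is the set of $\omega$ with $\mu_{\omega,0}(H_{\omega,\epsilon})>0$ for all $\epsilon>0$. For $k\ge0$, $$\hat q_{\omega,\epsilon}^{(k)}=\frac{\mu_{\sigma^{-(k+1)}\omega,0}\Big(T_{\sigma^{-(k+1)}\omega}^{-(k+1)}(H_{\omega,\epsilon})\cap\bigcap_{j=1}^kT_{\sigma^{-(k+1)}\omega}^{-(k+1)+j}(H^c_{\sigma^{-j}\omega,\epsilon})\cap H_{\sigma^{-(k+1)}\omega,\epsilon}\Big)}{\mu_{\sigma^{-(k+1)}\omega,0}\big(T_{\sigma^{-(k+1)}\omega}^{-(k+1)}(H_{\omega,\epsilon})\big)}.$$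 **Assumptions.** (C1') There is $C_1\ge1$ with $C_1^{-1}\le\mathcal L_{\omega,0}\mathbf 1\le C_1$ for $m$-a.e. $\omega$. (C2) For each $\epsilon\ge0$ there are a random measure $\{\nu_{\omega,\epsilon}\}$ supported in $\mathcal J_0$ and measurable $\lambda_\epsilon:\Omega\to(0,\infty)$ with $\log\lambda_{\omega,\epsilon}\in L^1(m)$, $\phi_\epsilon:\mathcal J_0\to\mathbb R$ with $\mathcal L_{\omega,\epsilon}\phi_{\omega,\epsilon}=\lambda_{\omega,\epsilon}\phi_{\sigma\omega,\epsilon}$, $\nu_{\sigma\omega,\epsilon}(\mathcal L_{\omega,\epsilon}f)=\lambda_{\omega,\epsilon}\nu_{\omega,\epsilon}(f)$ for $f\in\mathcal B_\omega$; for $m$-a.e. $\omega$, $\nu_{\omega,0}(\phi_{\omega,\epsilon})=1$ and $\nu_{\omega,0}(\mathbf 1)=1$ (for $\epsilon=0$ these are the closed objects). (C3) There is $Q_{\omega,\epsilon}:\mathcal B_\omega\to\mathcal B_{\sigma\omega}$ with, for $m$-a.e. $\omega$ and $f\in\mathcal B_\omega$, $\lambda_{\omega,\epsilon}^{-1}\mathcal L_{\omega,\epsilon}f=\nu_{\omega,\epsilon}(f)\phi_{\sigma\omega,\epsilon}+Q_{\omega,\epsilon}f$, $Q_{\omega,\epsilon}\phi_{\omega,\epsilon}=0$, $\nu_{\sigma\omega,\epsilon}(Q_{\omega,\epsilon}f)=0$. (C4') For each $f\in\mathcal B$ and $N\in\mathbb N$ there are $C_f>0$ and $\alpha(N)>0$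 (independent of $\omega$) with $\sum_{N\ge1}\alpha(N)<\infty$ such that for $m$-a.e. $\omega$ and all $N$, $\sup_{\epsilon\ge0}\|Q^N_{\omega,\epsilon}f_\omega\|_{\infty,\sigma^N\omega}\le C_f\alpha(N)\|f_\omega\|_{\mathcal B_\omega}$. (C5') There is $C_2\ge1$ with $\sup_{\epsilon\ge0}\|\phi_{\omega,\epsilon}\|_{\infty,\omega}\le C_2$ and $\|\phi_{\omega,0}\|_{\mathcal B_\omega}\le C_2$ for $m$-a.e. $\omega$. (C7') There is $C_3\ge1$ such that for all sufficiently small $\epsilon>0$, $\operatorname{ess\,inf}_\omega\inf\phi_{\omega,0}\ge C_3^{-1}>0$ and $\operatorname{ess\,inf}_\omega\inf\phi_{\omega,\epsilon}\ge0$. (C8) For $m$-a.e. $\omega\in\Omega_+$ the limit $\hat q_{\omega,0}^{(k)}:=\lim_{\epsilon\to0}\hat q_{\omega,\epsilon}^{(k)}$ exists for each $k\ge0$. (S) $t\in L^\infty(m)$ with $t>0$ is a fixed random scaling function, and $z_N,\xi_N\in L^\infty(m)$ and $W<\infty$ satisfy $\mu_{\omega,0}(H_{\omega,\epsilon_N})=(t_\omega+\xi_{\omega,N})/N$ for a.e. $\omega$ and each $N\ge1$, where $\lim_{N\to\infty}\xi_{\omega,N}=0$ for a.e. $\omega$ and $|\xi_{\omega,N}|\le W$ for a.e. $\omega$ and all $N\ge1$.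
   Formalization: Conformality of ν_{ω,0} is additionally assumed for the truncations 1_{X_{ω,n,ε}} f of f∈B_ω, X_{ω,n,ε} being the points avoiding the holes at times 0,…,n; with conformality on B_ω only, the claim fails (e.g. mixtures of Bernoulli measures with B_ω the functions of the first symbol). *)

(* Defs.v *)
From HB Require Import structures.
From mathcomp Require Import all_boot all_order all_algebra.
From mathcomp Require Import all_classical all_reals all_analysis.
From mathcomp Require Import ess_sup_inf measurable_realfun.

Set Implicit Arguments.
Unset Strict Implicit.
Unset Printing Implicit Defensive.

Import Order.TTheory GRing.Theory Num.Theory.
Import numFieldNormedType.Exports.

Local Open Scope classical_set_scope.
Local Open Scope ring_scope.

Definition borel (X : ptopologicalType) := g_sigma_algebraType (@open X).

(* Measurability on [D] for the trace sigma-algebra.  The library's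
   [measurable_fun D] is vacuous when [D] is not measurable, and the graph of a
   closed random set need not be when [X] is not separable. *)
Definition measurable_on d1 d2 (T1 : measurableType d1) (T2 : measurableType d2)
    (D : set T1) (f : T1 -> T2) : Prop :=
  forall Y, measurable Y -> strace measurable D (D `&` f @^-1` Y).

(* [cocycle s A n w] is A_{s^{n-1} w} \o ... \o A_{s w} \o A_w. *)
Fixpoint cocycle (I Y : Type) (s : I -> I) (A : I -> Y -> Y) (n : nat) (w : I)
    (y : Y) : Y :=
  if n is n'.+1 then A (iter n' s w) (cocycle s A n' w y) else y.

(* Unordered sum of a real family over an arbitrary index set; meaningful for
   absolutely summable families. *)
Definition rsum (R : realType) (I : choiceType) (A : set I) (u : I -> R) : R :=
  fine (\esum_(i in A) (Num.max (u i) 0)%:E) -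
  fine (\esum_(i in A) (Num.max (- u i) 0)%:E).

(* A real function on a subset [D] of [X] is represented by its extension by
   zero to [X].  [banach_function_space D B N]: the functions in [B], on [D],
   form a Banach space for the pointwise operations and the norm [N]. *)
Definition banach_function_space (R : realType) (X : Type) (D : set X)
    (B : set (X -> R)) (N : (X -> R) -> R) : Prop :=
  exists (V : completeNormedModType R) (ev : V -> X -> R),
    [/\ forall (a : R) (u v : V) (x : X), ev (a *: u + v) x = a * ev u x + ev v x,
        injective ev,
        range ev = B,
        forall u : V, N (ev u) = `|u| &
        forall (u : V) (x : X), ~ D x -> ev u x = 0].

Definition nonatomic d (T : measurableType d) (R : realType)
    (mu : set T -> \bar R) : Prop :=
  forall A, measurable A -> (0 < mu A)%E ->
    exists B, [/\ measurable B, B `<=` A, (0 < mu B)%E & (mu B < mu A)%E].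

(* The index [e : nat] of the objects below stands for the parameter epsilon:
   [0%N] is epsilon = 0 (the closed system), [N >= 1] is epsilon_N.
   The transition map [tmap w] only matters on [fib w]. *)
Record random_system (R : realType) d (Om : measurableType d)
    (X : completePseudoMetricType R) := RandomSystem {
  sigma : Om -> Om;
  sigma_inv : Om -> Om;
  fib : Om -> set X;                       (* J_{w,0} *)
  tmap : Om -> X -> X;                     (* T_w *)
  bspace : Om -> set (X -> R);             (* B_w *)
  bnorm : Om -> (X -> R) -> R;
  potential : Om -> X -> R;
  height : Om -> X -> R;                   (* h_w *)
  threshold : Om -> nat -> R;              (* z_{w,N}, for N >= 1 *)
  nu : nat -> R.-ker Om ~> borel X;        (* nu_{w,e} *)
  lam : nat -> Om -> R;                    (* lambda_{w,e} *)
  phi : nat -> Om -> X -> R;               (* phi_{w,e} *)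
  Qop : nat -> Om -> (X -> R) -> X -> R    (* Q_{w,e} *)
}.

Section Objects.
Context (R : realType) d (Om : measurableType d) (m : probability Om R)
  (X : completePseudoMetricType R) (S : random_system Om X).
Implicit Types (w : Om) (e N k n j : nat) (f : X -> R) (x : X).

Local Notation sg := (sigma S).
Local Notation sgV := (sigma_inv S).
Local Notation J := (fib S).

Definition graph : set (Om * borel X) := [set p | J p.1 p.2].

Definition skew (p : Om * borel X) : Om * borel X := (sg p.1, tmap S p.1 p.2).

Definition tmap_iter n w x : X := cocycle sg (tmap S) n w x.

Definition hole e w : set X :=
  if e is 0 then set0 else [set x | J w x /\ threshold S w e < height S w x].

Definition survivor n e w : set X :=
  [set x | J w x /\
    forall j, (j <= n)%N -> ~ hole e (iter j sg w) (tmap_iter j w x)].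

Definition survivor_inf e w : set X :=
  [set x | J w x /\ forall j, ~ hole e (iter j sg w) (tmap_iter j w x)].

Definition weight w : X -> R := fun x => expR (potential S w x) * \1_(J w) x.

Definition transfer w f : X -> R := fun x =>
  rsum [set y | J w y /\ tmap S w y = x] (fun y => f y * weight w y).

Definition open_transfer e w f : X -> R :=
  transfer w (fun y => \1_(J w `\` hole e w) y * f y).

Definition open_transfer_iter e n w f : X -> R :=
  cocycle sg (open_transfer e) n w f.

Definition Qop_iter e n w f : X -> R := cocycle sg (Qop S e) n w f.

Definition in_bspace (f : Om -> X -> R) : Prop := forall w, bspace S w (f w).

Definition measurable_family (f : Om -> X -> R) : Prop :=
  measurable_on graph (fun p => f p.1 p.2).

Definition nu_int e w f : R := \int[nu S e w]_x f x.

Definition Linfty_norm w f : \bar R := 'N[nu S 0 w]_+oo [EFin \o f].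

(* mu_{w,0} = phi_{w,0} nu_{w,0} *)
Definition mu w (A : set X) : \bar R :=
  (\int[nu S 0 w]_(x in (A : set (borel X))) (phi S 0 w x)%:E)%E.

(* The measure on (subsets of the graph in) Om * X with fibre measures [k w]. *)
Definition rmeasure (k : Om -> set (borel X) -> \bar R)
    (E : set (Om * borel X)) : \bar R :=
  (\int[m]_w k w (xsection E w))%E.

(* Fibre measures need not be probabilities: the normalisations nu_{w,0}(phi_{w,e}) = 1
   and nu_{w,e}(phi_{w,e}) = 1 leave the mass of nu_{w,e} free for e > 0. *)
Definition random_measure (k : Om -> set (borel X) -> \bar R) : Prop :=
  (forall A, measurable A -> measurable_fun [set: Om] (k ^~ A)) /\
  {ae m, forall w, k w (~` J w) = 0%E /\ (k w setT < +oo)%E}.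

Definition random_probability (k : Om -> set (borel X) -> \bar R) : Prop :=
  random_measure k /\ {ae m, forall w, k w setT = 1%E}.

Definition eigenfunction e : Prop :=
  forall w x, open_transfer e w (phi S e w) x = lam S e w * phi S e (sg w) x.

Definition conformal e : Prop :=
  forall w f, bspace S w f ->
    nu_int e (sg w) (open_transfer e w f) = lam S e w * nu_int e w f.

Record closed_system : Prop := ClosedSystem {
  sigmaK : cancel sg sgV;
  sigma_invK : cancel sgV sg;
  measurable_sigma : measurable_fun [set: Om] sg;
  measurable_sigma_inv : measurable_fun [set: Om] sgV;
  sigma_preserving : forall A, measurable A -> m (sg @^-1` A) = m A;
  sigma_ergodic : forall A, measurable A -> sg @^-1` A = A ->
    m A = 0%E \/ m A = 1%E;
  fib_closed : forall w, closed (J w);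
  (* measurability of a closed random set: w |-> dist(x, J_w) is measurable *)
  fib_measurable : forall x, measurable_fun [set: Om] (fun w => edist_inf (J w) x);
  tmap_fib : forall w x, J w x -> J (sg w) (tmap S w x);
  measurable_skew : measurable_on graph skew;
  bspace_banach : forall w, banach_function_space (J w) (bspace S w) (bnorm S w);
  bspace_Linfty : forall w f, bspace S w f ->
    (f : borel X -> R) \in Lfun (nu S 0 w) +oo%E;
  bspace_weight : in_bspace weight;
  bspace_one : in_bspace (fun w => \1_(J w));
  transfer_summable : forall w f, bspace S w f -> forall x,
    summable [set y | J w y /\ tmap S w y = x] (fun y => (f y * weight w y)%:E);
  transfer_bspace : forall w f, bspace S w f -> bspace S (sg w) (transfer w f);
  measurable_transfer : forall f : Om -> X -> R,
    in_bspace f -> measurable_family f ->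
    measurable_family (fun w => transfer (sgV w) (f (sgV w)));
  nu0_random : random_probability (fun w => nu S 0 w);
  nu0_nonatomic : {ae m, forall w, nonatomic (nu S 0 w)};
  lam0_measurable : measurable_fun [set: Om] (lam S 0);
  lam0_neq0 : forall w, lam S 0 w != 0;
  phi0_bspace : in_bspace (phi S 0);
  phi0_measurable : measurable_family (phi S 0);
  phi0_gt0 : forall w x, J w x -> 0 < phi S 0 w x;
  phi0_eigen : eigenfunction 0;
  nu0_conformal : conformal 0;
  lam0_def : forall w, lam S 0 w = nu_int 0 (sg w) (transfer w \1_(J w));
  lam0_log : m.-integrable [set: Om] (fun w => (ln (lam S 0 w))%:E);
  mu0_random : random_probability mu;
  mu0_invariant : forall E : set (Om * borel X), measurable E ->
    rmeasure mu (graph `&` skew @^-1` E) = rmeasure mu (graph `&` E)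
}.

Record open_system : Prop := OpenSystem {
  height_continuous : forall w, {within J w, continuous (height S w)};
  threshold_incr : forall w N N', (0 < N <= N')%N ->
    threshold S w N <= threshold S w N';
  threshold_between : {ae m, forall w, forall N, (0 < N)%N ->
    (ess_inf (nu S 0 w) (EFin \o height S w) <= (threshold S w N)%:E)%E /\
    ((threshold S w N)%:E <= ess_sup (nu S 0 w) (EFin \o height S w))%E};
  height_ess_lt : {ae m, forall w,
    (ess_inf (nu S 0 w) (EFin \o height S w) <
       ess_sup (nu S 0 w) (EFin \o height S w))%E};
  height_ess_null : {ae m, forall w, nu S 0 w
    [set x | J w x /\
      (ess_sup (nu S 0 w) (EFin \o height S w) < (height S w x)%:E)%E] = 0%E};
  hole_measurable : forall N, (0 < N)%N ->
    strace measurable graph [set p | hole N p.1 p.2];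
  hole_size : forall N, (0 < N)%N ->
    (0 < rmeasure (fun w => nu S 0 w) [set p | hole N p.1 p.2])%E /\
    (rmeasure (fun w => nu S 0 w) [set p | hole N p.1 p.2] < 1)%E;
  open_transfer_bspace : forall e w f, bspace S w f ->
    bspace S (sg w) (open_transfer e w f);
  survivor_neq0 : forall e, {ae m, forall w, survivor_inf e w !=set0};
  image_neq0 : forall e, {ae m, forall w,
    (\bigcap_n [set x | open_transfer_iter e n (iter n sgV w)
                          \1_(J (iter n sgV w)) x != 0]) !=set0};
  (* Conformality of nu_{w,0} extended to the truncations 1_{X_{w,n,e}} f of
     elements of B_w (X_{w,n,e} is [survivor n e w]), to which L_{w,0} is applied in
     L^n_{w,e} f = L^n_{w,0}(1_{X_{w,n-1,e}} f).  These truncations need not lie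
     in B_w, and if B_w is small (e.g. functions of the first symbol on a full
     shift) the property does not follow from conformality on B_w. *)
  nu0_conformal_truncated : forall e n w f, bspace S w f ->
    nu_int 0 (sg w) (transfer w (fun x => \1_(survivor n e w) x * f x)) =
    lam S 0 w * nu_int 0 w (fun x => \1_(survivor n e w) x * f x)
}.

Definition Omega_plus : set Om :=
  [set w | forall N, (0 < N)%N -> (0 < mu w (hole N w))%E].

Definition qhat N k w : R :=
  let w' := iter k.+1 sgV w in
  fine (mu w' [set x | [/\ J w' x,
                 hole N w (tmap_iter k.+1 w' x),
                 forall j, (1 <= j <= k)%N ->
                   ~ hole N (iter j sgV w) (tmap_iter (k.+1 - j) w' x) &
                 hole N w' x]]) /
  fine (mu w' [set x | J w' x /\ hole N w (tmap_iter k.+1 w' x)]).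

Definition qhat0 k w : R := limn (fun N => qhat N k w).

Definition theta w : R := 1 - limn (series (fun k => qhat0 k w)).

(* tau_{w,H_{w,N}}; it is +oo on points that never hit. *)
Definition hitting_time N w x : \bar R :=
  ereal_inf [set k%:R%:E | k in
    [set k | (1 <= k)%N /\ hole N (iter k sg w) (tmap_iter k w x)]].

Definition cond_C1 : Prop :=
  exists2 C1 : R, 1 <= C1 &
  {ae m, forall w, forall x, J (sg w) x ->
    C1^-1 <= transfer w \1_(J w) x <= C1}.

Record cond_C2 : Prop := CondC2 {
  C2_random : forall e, random_measure (fun w => nu S e w);
  C2_integrable : forall e w f, bspace S w f ->
    (nu S e w).-integrable [set: borel X] (EFin \o f);
  C2_lam_measurable : forall e, measurable_fun [set: Om] (lam S e);
  C2_lam_gt0 : forall e w, 0 < lam S e w;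
  C2_lam_log : forall e, m.-integrable [set: Om] (fun w => (ln (lam S e w))%:E);
  C2_phi_bspace : forall e, in_bspace (phi S e);
  C2_phi_measurable : forall e, measurable_family (phi S e);
  C2_eigen : forall e, eigenfunction e;
  C2_conformal : forall e, conformal e;
  C2_norm : forall e, {ae m, forall w,
    nu_int 0 w (phi S e w) = 1 /\ nu_int 0 w \1_(J w) = 1}
}.

Definition cond_C3 : Prop :=
  (forall e w f, bspace S w f -> bspace S (sg w) (Qop S e w f)) /\
  forall e, {ae m, forall w,
    [/\ forall f, bspace S w f -> forall x,
          (lam S e w)^-1 * open_transfer e w f x =
          nu_int e w f * phi S e (sg w) x + Qop S e w f x,
        forall x, Qop S e w (phi S e w) x = 0 &
        forall f, bspace S w f -> nu_int e (sg w) (Qop S e w f) = 0]}.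

Definition cond_C4 : Prop :=
  forall f : Om -> X -> R, in_bspace f ->
  exists (Cf : R) (alpha : nat -> R),
    [/\ 0 < Cf, forall N, 0 < alpha N, cvgn (series alpha) &
        {ae m, forall w, forall N, (0 < N)%N -> forall e,
          (Linfty_norm (iter N sg w) (Qop_iter e N w (f w)) <=
           (Cf * alpha N * bnorm S w (f w))%:E)%E}].

Definition cond_C5 : Prop :=
  exists2 C2 : R, 1 <= C2 &
  {ae m, forall w, (forall e, (Linfty_norm w (phi S e w) <= C2%:E)%E) /\
                   bnorm S w (phi S 0 w) <= C2}.

Definition ess_inf_phi e : \bar R :=
  ess_inf m (fun w => ereal_inf [set (phi S e w x)%:E | x in J w]).

Definition cond_C7 : Prop :=
  exists2 C3 : R, 1 <= C3 &
  \forall N \near \oo, ((C3^-1)%:E <= ess_inf_phi 0)%E /\ (0 <= ess_inf_phi N)%E.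

Definition cond_C8 : Prop :=
  {ae m, forall w, Omega_plus w -> forall k, cvgn (fun N => qhat N k w)}.

Record cond_S (t : Om -> R) (xi : nat -> Om -> R) (W : R) : Prop := CondS {
  S_t_Linfty : t \in Lfun m +oo%E;
  S_t_gt0 : {ae m, forall w, 0 < t w};
  S_z_Linfty : forall N, (0 < N)%N -> (threshold S ^~ N) \in Lfun m +oo%E;
  S_xi_Linfty : forall N, (0 < N)%N -> xi N \in Lfun m +oo%E;
  S_hole : forall N, (0 < N)%N -> {ae m, forall w,
    mu w (hole N w) = ((t w + xi N w) / N%:R)%:E};
  S_xi_cvg : {ae m, forall w, xi N w @[N --> \oo] --> 0};
  S_xi_bound : {ae m, forall w, forall N, (0 < N)%N -> `|xi N w| <= W}
}.

End Objects.

(* Main.v *)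
Require Import Defs.
From HB Require Import structures.
From mathcomp Require Import all_boot all_order all_algebra.
From mathcomp Require Import all_classical all_reals all_analysis.
From mathcomp Require Import ess_sup_inf measurable_realfun.
From mathcomp Require Import ring lra.

Set Implicit Arguments.
Unset Strict Implicit.
Unset Printing Implicit Defensive.

Import Order.TTheory GRing.Theory Num.Theory.
Import numFieldNormedType.Exports.

Local Open Scope classical_set_scope.
Local Open Scope ring_scope.

(** The limit law comes from first-order perturbation theory for the leading
    eigenvalue of the transfer operators, summed along an orbit by an ergodic
    theorem.

    Survival. By conformality, the [mu_0]-measure of the points that avoid the
    holes at the times [0, ..., n] is [nu_0(L_N^(n+1) phi_0) / lambda_0^(n+1)],
    where [L_N] is the open operator ([conformal_surv]). The spectral
    decomposition of [L_N] rewrites it as the product of the ratios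
    [lambda_N / lambda_0] along the orbit, times the sum of [nu_N(phi_0)] and an
    error that is summable in [n], uniformly in [N] ([mu_surv]). As [N] grows,
    [nu_N(phi_0)] tends to [1]: for a fixed number of steps hardly anything
    escapes ([nu_phi0_cvg1]).

    Eigenvalue drop. Let [lam_drop = 1 - lambda_N / lambda_0]. It equals
    [nu_0(1_H phi_N)] for the hole [H] ([lam_dropE]), and is thus [O(1 / N)].
    Its quotient by [mu_0(H)] tends to [theta]: the measure of the orbits that
    start [n] steps in the past and enter the hole for the first time now is, on
    the one hand, the drop up to factors tending to [1] and an error small with
    [n] ([mu_first_hit]) and, on the other hand, by invariance of the fibre
    measures, [mu_0(H)] times one minus the sum of the first [n] return
    probabilities [qhat] ([first_hit_massE]). The two limits [N -> oo] and
    [n -> oo] are then combined in [lam_drop_over_hole_mass_cvg].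

    Summation. Since [mu_0(H) = (t + xi_N) / N], the functions [N * lam_drop] are
    uniformly bounded and converge almost everywhere to [t * theta]. The sum of
    [lam_drop] over the first [N] points of the orbit is a Birkhoff average whose
    integrand depends on [N]; it converges almost surely to the integral of
    [t * theta] ([varying_birkhoff]), so that the product of the ratios
    [1 - lam_drop] over about [N] steps tends to the exponential of minus that
    integral ([prod_triangular_cvg]). Finally [tau * mu_0(H) > t] says that no
    hole is met at the times [1, ..., p] with [p] the integral part of
    [t / mu_0(H)], and [p / N] tends to [1] ([hitting_law]).

    Two points of measure theory need care. The invariance of [mu_0] is that of a
    measure on the product, and yields invariance of almost every fibre measure
    only for one family of sets at a time ([fibre_invariance]); countably many
    families suffice. The function [t * theta] is only almost everywhere equal to
    a measurable one, so its integral is compared with that of a measurable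
    function straight from the definition ([ae_eq_integral_any]). *)

Lemma exists_natr_ge (R : realType) (x : R) : exists p : nat, x <= p%:R.
Proof. by exists (Num.truncn x).+1; rewrite ltW// truncnS_gt. Qed.

(** * Integrals of almost everywhere equal functions *)

Section NonmeasurableIntegral.
Context d (T : measurableType d) (R : realType) (mu : {measure set T -> \bar R}).
Import HBNNSimple.
Local Open Scope ereal_scope.

Lemma ge0_ae_le_integral_any (f g : T -> \bar R) :
  (forall x, 0 <= f x) -> (forall x, 0 <= g x) ->
  {ae mu, forall x, f x = g x} -> \int[mu]_x f x <= \int[mu]_x g x.
Proof.
move=> f0 g0 [Z [mZ Z0 fgZ]].
have mZc : measurable (~` Z) by exact: measurableC.
rewrite (ge0_integralTE _ f0) (ge0_integralTE _ g0).
apply/ge_ereal_sup => _ /= [h hf <-].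
have -> : sintegral mu h = sintegral mu (proj_nnsfun h mZc).
  rewrite -(_ : h \_ (~` Z) = proj_nnsfun h mZc); last exact: mrestrict.
  rewrite -integral_nnsfun// (_ : sintegral mu h = sintegral mu (h \_ setT));
    last by rewrite patch_setT.
  rewrite -integral_nnsfun// (@ge0_negligible_integral _ _ _ mu setT Z)//.
  - by rewrite setTD.
  - exact/measurable_EFinP.
  - by move=> x _; rewrite lee_fin; exact: fun_ge0.
apply: ereal_sup_ubound; exists (proj_nnsfun h mZc) => // x.
rewrite -mrestrict /patch; case: ifPn => [|_]; last exact: g0.
rewrite inE /= => Zx; rewrite (le_trans (hf x))// le_eqVlt; apply/orP; left.
by apply/eqP; apply: contrapT => fg; apply: Zx; exact: fgZ.
Qed.

(** The integral of a non-measurable function is defined through the simple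
    functions below it, and cutting such a simple function off on a null set
    does not change its integral. *)
Lemma ae_eq_integral_any (f g : T -> \bar R) :
  {ae mu, forall x, f x = g x} -> \int[mu]_x f x = \int[mu]_x g x.
Proof.
move=> fg.
have gf : {ae mu, forall x, g x = f x} by apply: filterS fg => x ->.
rewrite integralE [RHS]integralE; congr (_ - _); apply/le_anti/andP; split;
  apply: ge0_ae_le_integral_any => //;
  by [apply: filterS fg => x fgx; rewrite ?funeposE ?funenegE fgx
     |apply: filterS gf => x fgx; rewrite ?funeposE ?funenegE fgx].
Qed.

End NonmeasurableIntegral.

(** * An ergodic theorem for averages with a varying integrand *)

Section Ergodic.
Context d (T : measurableType d) (R : realType) (m : probability T R).
Variables (s : T -> T).
Hypothesis ms : measurable_fun [set: T] s.
Hypothesis mps : forall A, measurable A -> m (s @^-1` A) = m A.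

Lemma ae_preimage (P : T -> Prop) :
  {ae m, forall w, P w} -> {ae m, forall w, P (s w)}.
Proof.
move=> [Z [mZ Z0 PZ]]; exists (s @^-1` Z); split.
- by rewrite -[X in measurable X]setTI; exact: ms.
- by rewrite mps.
- by move=> w /= Pw; apply: PZ.
Qed.

Lemma ae_orbit (P : T -> Prop) :
  {ae m, forall w, P w} -> {ae m, forall w n, P (iter n s w)}.
Proof.
move=> hP; apply: ae_foralln => n; elim: n => [//|n IH].
by apply: filterS (ae_preimage IH) => w; rewrite iterSr.
Qed.

Lemma bounded_mfun_integrable (f : T -> R) (K : R) :
  measurable_fun [set: T] f -> (forall w, `|f w| <= K) ->
  m.-integrable [set: T] (EFin \o f).
Proof.
move=> mf fK; apply: measurable_bounded_integrable => //.
  exact: le_lt_trans (probability_le1 m measurableT) (ltry _).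
exists K; split; first exact: num_real.
by move=> M KM w _ /=; rewrite (le_trans (fK w))// ltW.
Qed.

Lemma ge0_integral_preserving (f : T -> \bar R) (A : set T) :
  measurable A -> measurable_fun [set: T] f -> (forall w, 0 <= f w)%E ->
  (\int[m]_(w in s @^-1` A) f (s w) = \int[m]_(w in A) f w)%E.
Proof.
move=> mA mf f0.
rewrite -[LHS](@ge0_integral_pushforward _ _ _ _ _ _ ms m A f)//.
- by apply: eq_measure_integral => B mB _; exact: mps.
- exact: measurable_funTS.
Qed.

Lemma Rintegral_preserving (f : T -> R) (K : R) :
  measurable_fun [set: T] f -> (forall w, `|f w| <= K) ->
  \int[m]_w f (s w) = \int[m]_w f w.
Proof.
move=> mf fK; rewrite /Rintegral; congr fine.
rewrite -[LHS]/(\int[m]_(w in s @^-1` setT) ((EFin \o f) \o s) w)%E.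
rewrite -integral_pushforward//.
- by apply: eq_measure_integral => A mA _; exact: mps.
- exact/measurable_EFinP.
- rewrite preimage_setT -[_ \o _]/(EFin \o (f \o s)).
  apply: (@bounded_mfun_integrable _ K) => [|w]; last exact: fK.
  exact: measurableT_comp.
Qed.

Lemma bounded_cvg_Rintegral (f_ : nat -> T -> R) (f : T -> R) (K : R) :
  (forall n, measurable_fun [set: T] (f_ n)) -> measurable_fun [set: T] f ->
  (forall n w, `|f_ n w| <= K) -> {ae m, forall w, f_ n w @[n --> \oo] --> f w} ->
  \int[m]_w f_ n w @[n --> \oo] --> \int[m]_w f w.
Proof.
move=> mf_ mf fK cf.
have [|||||if_ _] := @dominated_convergence _ _ _ m setT measurableT
  (fun n => EFin \o f_ n) (EFin \o f) (EFin \o cst K).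
- by move=> n; exact/measurable_EFinP.
- exact/measurable_EFinP.
- by apply: filterS cf => w cw _; apply: cvg_EFin => //; exact: nearW.
- by apply: (@bounded_mfun_integrable _ `|K|) => // w.
- by apply: aeW => w n _; rewrite lee_fin.
rewrite -[X in _ --> X]fineK; last exact: integrable_fin_num.
by move=> /fine_cvg.
Qed.

(** The maximum of the Birkhoff sums of lengths [0], ..., [n], written as a
    recursion on the first step of the orbit. *)
Fixpoint max_sum (f : T -> R) n w : R :=
  if n is n'.+1 then Num.max 0 (f w + max_sum f n' (s w)) else 0.

Definition birkhoff_sum (f : T -> R) n w : R := \sum_(j < n) f (iter j s w).


Lemma birkhoff_sumS f n w :
  birkhoff_sum f n.+1 w = f w + birkhoff_sum f n (s w).
Proof.
rewrite /birkhoff_sum big_ord_recl; congr (_ + _).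
by apply: eq_bigr => i _; rewrite /= -iterSr.
Qed.

Lemma max_sum_ge0 f n w : 0 <= max_sum f n w.
Proof. by case: n => //= n; rewrite le_max lexx. Qed.

Lemma birkhoff_sum_le_max_sum f n w : birkhoff_sum f n w <= max_sum f n w.
Proof.
elim: n w => [|n IH] w; first by rewrite /birkhoff_sum big_ord0.
by rewrite birkhoff_sumS /= le_max lerD2l IH orbT.
Qed.

Lemma max_sum_homo f w : nondecreasing_seq (max_sum f ^~ w).
Proof.
apply/nondecreasing_seqP => n; elim: n w => [|n IH] w; first exact: max_sum_ge0.
rewrite [leLHS]/= [leRHS]/= ge_max le_max lexx /= le_max.
by rewrite lerD2l IH orbT.
Qed.

Lemma measurable_max_sum f n : measurable_fun [set: T] f ->
  measurable_fun [set: T] (max_sum f n).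
Proof.
move=> mf; elim: n => [|n IH] /=; first exact: measurable_cst.
apply: measurable_maxr; first exact: measurable_cst.
by apply: measurable_funD => //; exact: (measurableT_comp IH ms).
Qed.

Lemma max_sum_bound f (K : R) n w : (forall w, `|f w| <= K) ->
  `|max_sum f n w| <= n%:R * K.
Proof.
move=> fK; rewrite ger0_norm ?max_sum_ge0//; elim: n w => [|n IH] w /=.
  by rewrite mul0r.
have K0 : 0 <= K by exact: le_trans (fK w).
rewrite ge_max mulr_ge0//= -natr1 mulrDl mul1r addrC lerD//.
exact: le_trans (ler_norm _) (fK w).
Qed.

Hypothesis erg : forall A, measurable A -> s @^-1` A = A ->
  m A = 0%E \/ m A = 1%E.

(** Removing the first term of the sums changes them by a finite amount, so the
    set is invariant on the nose and not just up to a null set, as the ergodicity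
    hypothesis demands. *)
Lemma max_sum_unbounded_invariant f :
  let A := \bigcap_k \bigcup_n [set w | k%:R < max_sum f n w] in
  s @^-1` A = A.
Proof.
move=> A; apply/seteqP; split => w Aw k _ /=.
- have [p hp] : exists p : nat, k%:R - f w <= p%:R.
    exact: exists_natr_ge.
  have [n _ /= hn] := Aw p I.
  exists n.+1 => //=; rewrite lt_max; apply/orP; right.
  by rewrite -ltrBlDl (le_lt_trans hp).
- have [p hp] : exists p : nat, f w + k%:R <= p%:R.
    exact: exists_natr_ge.
  have [[|n] _ /= hn] := Aw p I.
    by exists 0%N => //=; move: hn; rewrite ltNge ler0n.
  exists n => //=; move: hn; rewrite lt_max => /orP[|hn].
    by rewrite ltNge ler0n.
  by rewrite -(ltrD2l (f w)) (le_lt_trans hp).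
Qed.

(** With [M_n = max (0, S_1 f, ..., S_n f)] one has
    [M_(n+1) - M_n \o s = max (- M_n \o s, f)], of nonnegative integral; if
    [M_n] were unbounded then this difference would tend to [f]. *)
Lemma birkhoff_sum_bounded_above (f : T -> R) (K : R) :
  measurable_fun [set: T] f -> (forall w, `|f w| <= K) -> \int[m]_w f w < 0 ->
  {ae m, forall w, exists B : R, forall n, birkhoff_sum f n w <= B}.
Proof.
move=> mf fK fneg.
pose A := \bigcap_k \bigcup_n [set w | k%:R < max_sum f n w].
have mA : measurable A.
  apply: bigcapT_measurable => k; apply: bigcupT_measurable => n.
  rewrite -[X in measurable X]setTI -[X in _ `&` X]/(_ @^-1` [set x | _ < x]).
  rewrite -set_itvoy; apply: measurable_max_sum => //; exact: measurable_itv.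
have [A0|A1] := erg mA (max_sum_unbounded_invariant f).
  exists A; split => // w /= nB; apply: contrapT => nA; apply: nB.
  move/existsNP : nA => [k /not_implyP[_ nk]].
  exists k%:R => n; rewrite (le_trans (birkhoff_sum_le_max_sum _ _ _))//.
  by rewrite leNgt; apply/negP => hk; apply: nk; exists n.
(* [A] has full measure: the differences [D n] then tend to [f], so that the
   integral of [f] cannot be negative. *)
exfalso.
have aeA : {ae m, forall w, A w}.
  exists (~` A); split => //; first exact: measurableC.
  by rewrite probability_setC// A1 subee.
pose D n w := max_sum f n.+1 w - max_sum f n (s w).
have DE n w : D n w = Num.max (- max_sum f n (s w)) (f w).
  rewrite /D /=; case: (leP 0 (f w + max_sum f n (s w))) => h.
    by rewrite addrK; rewrite max_r// lerNl -subr_ge0 opprK addrC.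
  by rewrite sub0r max_l// lerNr -subr_ge0 -opprD oppr_ge0 ltW.
have DK n w : `|D n w| <= K.
  have := fK w; rewrite DE !ler_norml => /andP[h1 h2].
  rewrite le_max h1 orbT/= ge_max h2 andbT.
  by rewrite (@le_trans _ _ 0)// ?oppr_le0 ?max_sum_ge0// (le_trans _ (fK w)).
have mD n : measurable_fun [set: T] (D n).
  apply: measurable_funB; first exact: measurable_max_sum.
  exact: (measurableT_comp (measurable_max_sum n mf) ms).
have D0 n : 0 <= \int[m]_w D n w.
  have iM k : m.-integrable [set: T] (EFin \o max_sum f k).
    apply: (@bounded_mfun_integrable _ (k%:R * K)) => //.
      exact: measurable_max_sum.
    by move=> w; exact: max_sum_bound.
  rewrite RintegralB//; last first.
    rewrite -[_ \o _]/(EFin \o (max_sum f n \o s)).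
    apply: (@bounded_mfun_integrable _ (n%:R * K)) => //.
      exact: (measurableT_comp (measurable_max_sum n mf) ms).
    by move=> w; exact: max_sum_bound.
  rewrite (@Rintegral_preserving _ (n%:R * K)); last 2 first.
    exact: measurable_max_sum.
    by move=> w; exact: max_sum_bound.
  rewrite subr_ge0; apply: le_Rintegral => // w _.
  exact: max_sum_homo.
have cD : \int[m]_w D n w @[n --> \oo] --> \int[m]_w f w.
  apply: (bounded_cvg_Rintegral mD mf DK).
  apply: filterS (ae_preimage aeA) => w Asw.
  have [p hp] : exists p : nat, - f w <= p%:R.
    exact: exists_natr_ge.
  have [n0 _ /= hn0] := Asw p I.
  apply: cvg_near_cst; exists n0 => // n /= n0n; rewrite DE max_r//.
  rewrite lerNl (le_trans hp)// ltW// (lt_le_trans hn0)//.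
  exact: max_sum_homo.
have : 0 <= \int[m]_w f w.
  by apply: (cvgr_to_ge cD); exact: nearW.
by rewrite leNgt fneg.
Qed.

End Ergodic.

Lemma Rintegral_probability_cst d (T : measurableType d) (R : realType)
  (m : probability T R) (r : R) : \int[m]_w r = r.
Proof. by rewrite Rintegral_cst// [X in fine X]probability_setT mulr1. Qed.

Section VaryingBirkhoff.
Context d (T : measurableType d) (R : realType) (m : probability T R).
Variables (s : T -> T).
Hypothesis ms : measurable_fun [set: T] s.
Hypothesis mps : forall A, measurable A -> m (s @^-1` A) = m A.
Hypothesis erg : forall A, measurable A -> s @^-1` A = A ->
  m A = 0%E \/ m A = 1%E.

(** The upper half of Birkhoff's theorem: [f - b], with [b] strictly between the
    mean of [f] and [a], has bounded sums, and [n * (a - b)] absorbs the bound. *)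
Lemma birkhoff_sum_eventually_le (f : T -> R) (K a : R) :
  measurable_fun [set: T] f -> (forall w, `|f w| <= K) -> \int[m]_w f w < a ->
  {ae m, forall w, \forall n \near \oo, birkhoff_sum s f n w <= n%:R * a}.
Proof.
move=> mf fK fa; pose I := \int[m]_w f w; pose b := (I + a) / 2.
have Ib : I < b by rewrite /b; rewrite -/I in fa; lra.
have ba : b < a by rewrite /b; rewrite -/I in fa; lra.
have mfb : measurable_fun [set: T] (fun w => f w - b).
  by apply: measurable_funB => //; exact: measurable_cst.
have fbK w : `|f w - b| <= K + `|b|.
  by rewrite (le_trans (ler_normB _ _))// lerD2r.
have intf := bounded_mfun_integrable m mf fK.
have fb0 : \int[m]_w (f w - b) < 0.
  rewrite RintegralB//; last first.
    by apply: (@bounded_mfun_integrable _ _ _ m (cst b) `|b|).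
  rewrite Rintegral_probability_cst; rewrite -/I; lra.
have := birkhoff_sum_bounded_above ms mps erg mfb fbK fb0.
apply: filterS => w [B hB].
have [p hp] := exists_natr_ge (B / (a - b)).
exists p => // n /= pn.
have := hB n.
have -> : birkhoff_sum s (fun w => f w - b) n w = birkhoff_sum s f n w - n%:R * b.
  by rewrite /birkhoff_sum sumrB sumr_const card_ord mulr_natl.
have {}hp : B <= n%:R * (a - b).
  rewrite -ler_pdivrMr; last by lra.
  by rewrite (le_trans hp)// ler_nat.
lra.
Qed.

Lemma varying_birkhoff_upper (f_ : nat -> T -> R) (f : T -> R) (K a : R) :
  (forall n, measurable_fun [set: T] (f_ n)) -> measurable_fun [set: T] f ->
  (forall n w, `|f_ n w| <= K) -> {ae m, forall w, f_ n w @[n --> \oo] --> f w} ->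
  \int[m]_w f w < a ->
  {ae m, forall w, \forall n \near \oo, birkhoff_sum s (f_ n) n w <= n%:R * a}.
Proof.
move=> mf_ mf fK cf fa.
pose U M w := sups (fun n => f_ n w) M.
have ub w : has_ubound (range (fun n => f_ n w)).
  by exists K => _ [n _ <-]; rewrite (le_trans (ler_norm _)).
have U_ge M n w : (M <= n)%N -> f_ n w <= U M w.
  move=> Mn; apply: ub_le_sup; first exact: has_ubound_sdrop.
  by exists n.
have UK M w : `|U M w| <= K.
  rewrite ler_norml; apply/andP; split.
    rewrite (le_trans _ (U_ge M M w _))//.
    by have := fK M w; rewrite ler_norml => /andP[].
  apply: ge_sup; first by exists (f_ M w); exists M => //=.
  by move=> _ [n _ <-]; rewrite (le_trans (ler_norm _)).
have mU M : measurable_fun [set: T] (U M) by exact: measurable_fun_sups.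
have cU : \int[m]_w U M w @[M --> \oo] --> \int[m]_w f w.
  apply: (bounded_cvg_Rintegral mU mf UK).
  by apply: filterS cf => w; exact: cvg_sups.
have [M _ /(_ M (leqnn M)) /= UMa] := cvgr_lt _ cU _ fa.
have := birkhoff_sum_eventually_le (mU M) (UK M) UMa.
apply: filterS => w hw; near=> n.
have Mn : (M <= n)%N by near: n; exact: nbhs_infty_ge.
apply: (@le_trans _ _ (birkhoff_sum s (U M) n w)); last by near: n.
by apply: ler_sum => i _; exact: U_ge.
Unshelve. all: by end_near. Qed.

(** Birkhoff's theorem for averages whose integrand varies with the length of
    the average: the tail suprema [U_M = sup_(n >= M) f_n] dominate every
    [f_n] with [n >= M], and their integrals decrease to that of the limit. *)
Lemma varying_birkhoff (f_ : nat -> T -> R) (f : T -> R) (K : R) :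
  (forall n, measurable_fun [set: T] (f_ n)) -> measurable_fun [set: T] f ->
  (forall n w, `|f_ n w| <= K) -> {ae m, forall w, f_ n w @[n --> \oo] --> f w} ->
  {ae m, forall w, n%:R^-1 * birkhoff_sum s (f_ n) n w @[n --> \oo]
     --> \int[m]_w f w}.
Proof.
move=> mf_ mf fK cf.
have fKlim : {ae m, forall w, `|f w| <= K}.
  apply: filterS cf => w cw.
  by apply: (cvgr_to_le (cvg_norm cw)); apply: nearW => n; exact: fK.
have up (k : nat) : {ae m, forall w, \forall n \near \oo,
    birkhoff_sum s (f_ n) n w <= n%:R * (\int[m]_w f w + k.+1%:R^-1)}.
  by apply: (varying_birkhoff_upper mf_ mf fK cf); rewrite ltrDl.
have dn (k : nat) : {ae m, forall w, \forall n \near \oo,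
    birkhoff_sum s (fun w => - f_ n w) n w
      <= n%:R * (- (\int[m]_w f w) + k.+1%:R^-1)}.
  apply: (@varying_birkhoff_upper (fun n w => - f_ n w) (fun w => - f w) K) => //.
  - by move=> n; exact: measurableT_comp.
  - exact: measurableT_comp.
  - by move=> n w; rewrite normrN.
  - by apply: filterS cf => w; exact: cvgN.
  - have -> : \int[m]_w (- f w) = - (\int[m]_w f w).
      under eq_Rintegral do rewrite -mulN1r.
      rewrite RintegralZl ?mulN1r//.
      have [Z [mZ Z0 fZ]] := fKlim.
      apply/integrableP; split; first exact/measurable_EFinP.
      apply: (@le_lt_trans _ _ (\int[m]_w (`|K|)%:E)%E); last first.
        by rewrite integral_cst// [X in (_ * X)%E]probability_setT mule1 ltry.
      apply: ae_ge0_le_integral => //.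
      + exact/measurableT_comp/measurable_EFinP.
      + apply: filterS fKlim => w fw _; rewrite lee_fin (le_trans fw)//.
        exact: ler_norm.
    by rewrite ltrDl.
have := ae_foralln up; have := ae_foralln dn.
apply: filterS2 => w hdn hup.
apply/cvgrPdist_le => e e0.
have [k hk] : exists k : nat, k.+1%:R^-1 <= e.
  have [p hp] := exists_natr_ge e^-1; exists p.
  rewrite invf_ple ?posrE//; first by rewrite (le_trans hp)// ler_nat.
near=> n.
have n0 : (0 < n)%N by near: n; exact: nbhs_infty_gt.
have n0R : 0 < n%:R :> R by rewrite ltr0n.
have h1 : birkhoff_sum s (f_ n) n w <= n%:R * (\int[m]_w f w + k.+1%:R^-1).
  by near: n; exact: hup.
have h2 : - birkhoff_sum s (f_ n) n w <= n%:R * (- (\int[m]_w f w) + k.+1%:R^-1).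
  by rewrite /birkhoff_sum -sumrN; near: n; exact: hdn.
have := ler_wpM2l (ltW n0R) hk.
move: h1 h2; set q := k.+1%:R^-1; set I := \int[m]_w f w.
set S := birkhoff_sum _ _ _ _; set N := n%:R in n0R * => h1 h2 h3.
rewrite ler_distlC [_^-1 * _]mulrC; apply/andP; split.
  rewrite ler_pdivlMr// mulrC; nra.
by rewrite ler_pdivrMr// mulrC; nra.
Unshelve. all: by end_near. Qed.

End VaryingBirkhoff.

(** * Limits of triangular arrays *)

Section RealLimits.
Context (R : realType).
Implicit Types (a u l b : nat -> R).

(** Exchange of limits: first choose [n] so that [b n] and the distance from
    [l n] to [c] are small, and only then [N]. *)
Lemma cvg_by_approximation a (u : nat -> nat -> R) l b (c : R) :
  (forall n, \forall N \near \oo, `|a N - u n N| <= b n) ->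
  (forall n, u n N @[N --> \oo] --> l n) ->
  b n @[n --> \oo] --> 0 -> l n @[n --> \oo] --> c ->
  a N @[N --> \oo] --> c.
Proof.
move=> au ul b0 lc; apply/cvgrPdist_le => /= e e0.
have e3 : 0 < e / 3 by rewrite divr_gt0.
have [n [bn ln]] : exists n, b n <= e / 3 /\ `|c - l n| <= e / 3.
  move/cvgrPdist_le : (lc) => /(_ _ e3) [p _ hp].
  have [q _ hq] : \forall n \near \oo, b n <= e / 3 by exact: (cvgr_le _ b0).
  by exists (maxn p q); split; [apply: hq|apply: hp]; rewrite /= leq_max leqnn ?orbT.
near=> N.
have h1 : `|a N - u n N| <= b n by near: N; exact: au.
have h2 : `|l n - u n N| <= e / 3.
  by near: N; move/cvgrPdist_le : (ul n) => /(_ _ e3).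
rewrite (_ : c - a N = (c - l n) + (l n - u n N) - (a N - u n N)); last by lra.
rewrite (le_trans (ler_normB _ _))//.
have := ler_normD (c - l n) (l n - u n N); lra.
Unshelve. all: by end_near. Qed.

(** The lower bound is [1 + y <= exp y] at [y = x / (1 - x)], together with
    [x / (1 - x) <= x + 2 * x ^ 2]. *)
Lemma expR_le_1B (x : R) : x <= 1 / 2 ->
  expR (- x - 2 * x ^+ 2) <= 1 - x <= expR (- x).
Proof.
move=> x2; have x1 : 0 < 1 - x by lra.
apply/andP; split; last exact: expR_ge1Dx.
have := expR_ge1Dx (x / (1 - x)).
have -> : 1 + x / (1 - x) = (1 - x)^-1 by field; rewrite gt_eqF.
rewrite -[expR _]invrK lef_pV2 ?posrE ?invr_gt0 ?expR_gt0// -expRN => h.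
apply: le_trans h; rewrite ler_expR.
rewrite -subr_ge0.
have -> : - (x / (1 - x)) - (- x - 2 * x ^+ 2) = x ^+ 2 * (1 - 2 * x) / (1 - x).
  by field; rewrite gt_eqF.
by apply: divr_ge0; [apply: mulr_ge0; [exact: sqr_ge0|lra]|lra].
Qed.

Lemma prod_1B_bounds n (x : nat -> R) (c : R) :
  (forall j, `|x j| <= c) -> c <= 1 / 2 ->
  expR (- (\sum_(j < n) x j) - 2 * (n%:R * c ^+ 2)) <= \prod_(j < n) (1 - x j)
    <= expR (- \sum_(j < n) x j).
Proof.
move=> xc c2; rewrite -sumrN !expRD; have xle j : x j <= 1 / 2.
  by rewrite (le_trans _ c2)// (le_trans (ler_norm _)).
apply/andP; split; last first.
  rewrite expR_sum; apply: ler_prod => j _.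
  have /andP[h1 ->] := expR_le_1B (xle j).
  by rewrite (le_trans (expR_ge0 _) h1).
rewrite -expRD; apply: (@le_trans _ _ (\prod_(j < n) expR (- x j - 2 * x j ^+ 2))).
  rewrite -expR_sum ler_expR sumrB lerD2l lerN2 -mulr_sumr ler_pM2l//.
  apply: (@le_trans _ _ (\sum_(j < n) c ^+ 2)); last first.
    by rewrite sumr_const card_ord mulr_natl.
  apply: ler_sum => j _; rewrite -[x j ^+ 2]real_normK ?num_real//.
  by rewrite lerXn2r ?nnegrE// (le_trans _ (xc j)).
by apply: ler_prod => j _; rewrite expR_ge0/=; have /andP[] := expR_le_1B (xle j).
Qed.

Lemma sum_ord_dist (x : nat -> R) (c : R) p q : (forall j, `|x j| <= c) ->
  `|\sum_(j < p) x j - \sum_(j < q) x j| <= `|p%:R - q%:R| * c.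
Proof.
move=> xc; wlog pq : p q / (p <= q)%N => [H|].
  have [/H//|/ltnW/H] := leqP p q.
  by rewrite [in X in X -> _]distrC [in X in X -> _](distrC q%:R).
rewrite -!(big_mkord xpredT) distrC (distrC p%:R) -natrB//.
rewrite (big_cat_nat (n := p) (leq0n p) pq)/= [X in `|X| <= _]addrAC subrr add0r normr_nat.
rewrite (le_trans (ler_norm_sum _ _ _))//.
apply: (@le_trans _ _ (\sum_(p <= i < q) c)); first exact: ler_sum.
by rewrite sumr_const_nat mulr_natl.
Qed.

Lemma cvg_invn0 (c : R) : c / N%:R @[N --> \oo] --> (0 : R).
Proof.
rewrite -[X in _ --> X](mulr0 c); apply: cvgMr.
apply/gtr0_cvgV0 => /=; last exact: cvgr_idn.
by near=> N; rewrite ltr0n; near: N; exact: nbhs_infty_gt.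
Unshelve. all: by end_near. Qed.

Lemma trunc_ratio_cvg (r : nat -> R) : r N @[N --> \oo] --> (1 : R) ->
  (Num.truncn (N%:R * r N))%:R / N%:R @[N --> \oo] --> (1 : R).
Proof.
move=> r1.
have inv0 : N%:R^-1 @[N --> \oo] --> (0 : R).
  by have := cvg_invn0 1; under eq_fun do rewrite mul1r.
apply: (@squeeze_cvgr _ _ _ _ (fun N => r N - N%:R^-1) r) => //; last first.
  by rewrite -[X in _ --> X]subr0; exact: cvgB.
near=> N.
have N0 : 0 < N%:R :> R by rewrite ltr0n; near: N; exact: nbhs_infty_gt.
have r0 : 0 < r N by near: N; exact: (cvgr_gt _ r1).
have Nr : 0 <= N%:R * r N by rewrite mulr_ge0 ?ltW.
rewrite ler_pdivlMr// ler_pdivrMr// mulrBl mulVf ?gt_eqF// (mulrC (r N)).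
have /andP[h1 h2] := truncn_itv Nr.
by rewrite h1 andbT lerBlDr natr1 ltW.
Unshelve. all: by end_near. Qed.

(** The logarithm of the product is minus the sum of the factors' [x_j], up to a
    sum of squares of order [1 / N]; replacing the length [N] of the sum by
    [p N] costs [|p N - N| * K / N], which vanishes. *)
Lemma prod_triangular_cvg (x : nat -> nat -> R) (K I : R) (p : nat -> nat) :
  (forall N j, (0 < N)%N -> `|x N j| <= K / N%:R) ->
  \sum_(j < N) x N j @[N --> \oo] --> I ->
  (p N)%:R / N%:R @[N --> \oo] --> (1 : R) ->
  \prod_(j < p N) (1 - x N j) @[N --> \oo] --> expR (- I).
Proof.
move=> xK sI p1.
have KN0 : K / N%:R @[N --> \oo] --> (0 : R) by exact: cvg_invn0.
have spI : \sum_(j < p N) x N j @[N --> \oo] --> I.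
  have d0 : \sum_(j < p N) x N j - \sum_(j < N) x N j @[N --> \oo] --> (0 : R).
    apply/norm_cvg0P.
    apply: (@squeeze_cvgr _ _ _ _ (cst 0)
      (fun N => `|(p N)%:R / N%:R - 1| * K)); last 2 first.
    - exact: cvg_cst.
    - rewrite -[X in _ --> X](mul0r K); apply: cvgMl.
      rewrite -[X in _ --> X](normr0 R); apply: cvg_norm.
      by rewrite -[X in _ --> X](subrr (1 : R)); apply: cvgB => //; exact: cvg_cst.
    near=> N.
    have N0 : (0 < N)%N by near: N; exact: nbhs_infty_gt.
    have N0' : 0 < N%:R :> R by rewrite ltr0n.
    rewrite normr_ge0/= (le_trans (sum_ord_dist (p N) N (fun j => xK N j N0)))//.
    rewrite [K / _]mulrC mulrA ler_wpM2r//.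
      by have := xK N 0%N N0; move=> /(le_trans (normr_ge0 _)); rewrite pmulr_lge0 ?invr_gt0.
    rewrite -[X in _ * X](@gtr0_norm _ N%:R^-1) ?invr_gt0// -normrM mulrBl.
    by rewrite mulfV ?gt_eqF.
  rewrite -[X in _ --> X]add0r.
  rewrite (_ : (fun N => _) = (fun N => (\sum_(j < p N) x N j - \sum_(j < N) x N j)
     + \sum_(j < N) x N j)); last by apply/funext => N; rewrite subrK.
  exact: cvgD.
have e0 : 2 * ((p N)%:R * (K / N%:R) ^+ 2) @[N --> \oo] --> (0 : R).
  rewrite (_ : (fun N => _) = (fun N => 2 * (((p N)%:R / N%:R) * K * (K / N%:R)))).
    rewrite -[X in _ --> X](mulr0 2); apply: cvgMr.
    rewrite -[X in _ --> X](mulr0 (1 * K)); apply: cvgM => //; exact: cvgMl.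
  by apply/funext => N; rewrite expr2; ring.
apply: (@squeeze_cvgr _ _ _ _
   (fun N => expR (- (\sum_(j < p N) x N j) - 2 * ((p N)%:R * (K / N%:R) ^+ 2)))
   (fun N => expR (- \sum_(j < p N) x N j))).
- near=> N.
  have N0 : (0 < N)%N by near: N; exact: nbhs_infty_gt.
  apply: prod_1B_bounds => [j|]; first exact: xK.
  by near: N; apply: (cvgr_le _ KN0); lra.
- apply: (@continuous_cvg _ _ _ _ _ _ (@expR R)); first exact: continuous_expR.
  by rewrite -[X in _ --> X]subr0; apply: cvgB => //; exact: cvgN.
- apply: (@continuous_cvg _ _ _ _ _ _ (@expR R)); first exact: continuous_expR.
  exact: cvgN.
Unshelve. all: by end_near. Qed.

End RealLimits.

(** * Linearity of unordered sums *)

Section UnorderedSums.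
Context (R : realType) (I : choiceType) (A : set I).
Implicit Types (u v p q : I -> R).

Let Ssum p : \bar R := (\esum_(i in A) (p i)%:E)%E.

Lemma summable_max0 u : summable A (EFin \o u) ->
  summable A (fun i => (Num.max (u i) 0)%:E).
Proof.
apply: le_lt_trans; apply: le_esum => i Ai /=; rewrite lee_fin.
by case: (leP (u i) 0) => h; rewrite ?normr0.
Qed.

Let SsumD (x y : I -> R) : (forall i, 0 <= x i) -> (forall i, 0 <= y i) ->
   (Ssum (fun i => x i + y i)%R = Ssum x + Ssum y)%E.
Proof. by move=> x0 y0; rewrite /Ssum -esumD// => i _; rewrite lee_fin. Qed.

Let ge0_fin_esum p : (forall i, 0 <= p i) -> summable A (EFin \o p) ->
  (Ssum p \is a fin_num)%E.
Proof.
move=> p0; rewrite summableE; congr (_ \is a fin_num).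
by apply: eq_esum => i _ /=; rewrite ger0_norm.
Qed.

(** The positive and negative parts may be replaced by any decomposition [p - q]:
    adding crosswise turns [u^+ - u^- = p - q] into an identity between sums of
    nonnegative families. *)
Lemma rsum_posneg u p q :
  (forall i, 0 <= p i) -> (forall i, 0 <= q i) ->
  summable A (EFin \o p) -> summable A (EFin \o q) ->
  summable A (EFin \o u) -> (forall i, A i -> u i = p i - q i) ->
  rsum A u = fine (Ssum p) - fine (Ssum q).
Proof.
move=> p0 q0 sp sq su upq.
have suN : summable A (EFin \o (fun i => - u i)) by move: su; rewrite summableN.
have fp := ge0_fin_esum p0 sp; have fq := ge0_fin_esum q0 sq.
have m0 v i : 0 <= Num.max (v i) 0 by rewrite le_max lexx orbT.
have fu := ge0_fin_esum (m0 u) (summable_max0 su).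
have fv := ge0_fin_esum (m0 (fun i => - u i)) (summable_max0 suN).
have h : (Ssum (fun i => Num.max (u i) 0)%R + Ssum q =
        Ssum (fun i => Num.max (- u i) 0)%R + Ssum p)%E.
  rewrite -(SsumD (m0 u) q0) -(SsumD (m0 (fun i => - u i)) p0).
  apply: eq_esum => i Ai; congr EFin.
  have := upq i Ai; case: (leP (u i) 0); case: (leP (- u i) 0); lra.
move: h => /(congr1 (@fine R)); rewrite !fineD// => h; rewrite /rsum.
by move: h; rewrite /Ssum; lra.
Qed.

Let le_SsumZ (a : R) p : 0 < a -> (forall i, 0 <= p i) ->
  (Ssum (fun i => a * p i)%R <= a%:E * Ssum p)%E.
Proof.
move=> a0 p0; apply: ge_ereal_sup => _ [F [fF FA] <-].
under eq_fsbigr do rewrite EFinM.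
rewrite -ge0_mule_fsumr; last by move=> i; rewrite lee_fin.
by rewrite lee_pmul2l// ?ltry//; apply: ereal_sup_ubound; exists F.
Qed.

Let SsumZ (a : R) p : 0 < a -> (forall i, 0 <= p i) ->
  Ssum (fun i => a * p i) = (a%:E * Ssum p)%E.
Proof.
move=> a0 p0; apply/le_anti/andP; split; first exact: le_SsumZ.
have ap0 i : 0 <= a * p i by rewrite mulr_ge0// ltW.
have ai : 0 < a^-1 by rewrite invr_gt0.
have := le_SsumZ ai ap0.
rewrite -(@lee_pmul2l _ a%:E)// ?lte_fin// muleA -EFinM divff ?gt_eqF// mul1e.
by rewrite (_ : (fun i => _) = p)//; apply/funext => i; rewrite mulKf ?gt_eqF.
Qed.

Lemma summableZ (a : R) u : summable A (EFin \o u) ->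
  summable A (EFin \o (fun i => a * u i)).
Proof.
move=> su; have [->|a0] := eqVneq a 0.
  rewrite /summable esum1//= => i _; by rewrite mul0r normr0.
have na : 0 < `|a| by rewrite normr_gt0.
rewrite /summable (eq_esum (b := fun i => (`|a| * `|u i|)%:E)); last first.
  by move=> i _ /=; rewrite normrM.
rewrite -[X in (X < _)%E]/(Ssum _) SsumZ// lte_mul_pinfty// lee_fin ltW//.
Qed.

Lemma rsumD u v : summable A (EFin \o u) -> summable A (EFin \o v) ->
  rsum A (fun i => u i + v i) = rsum A u + rsum A v.
Proof.
move=> su sv.
have suN : summable A (EFin \o (fun i => - u i)) by move: su; rewrite summableN.
have svN : summable A (EFin \o (fun i => - v i)) by move: sv; rewrite summableN.
have m0 (w : I -> R) i : 0 <= Num.max (w i) 0 by rewrite le_max lexx orbT.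
have D (x y : I -> R) := @summableD _ _ A (EFin \o x) (EFin \o y).
have Mu := summable_max0 su; have Mv := summable_max0 sv.
have MuN := summable_max0 suN; have MvN := summable_max0 svN.
rewrite (@rsum_posneg _ (fun i => Num.max (u i) 0 + Num.max (v i) 0)
   (fun i => Num.max (- u i) 0 + Num.max (- v i) 0)
   (fun i => addr_ge0 (m0 u i) (m0 v i))
   (fun i => addr_ge0 (m0 (fun i => - u i) i) (m0 (fun i => - v i) i))
   (D _ _ Mu Mv) (D _ _ MuN MvN) (D _ _ su sv)); last first.
  move=> i _; case: (leP (u i) 0); case: (leP (- u i) 0);
    case: (leP (v i) 0); case: (leP (- v i) 0); lra.
rewrite /rsum.
rewrite (SsumD (m0 u) (m0 v)).
rewrite (SsumD (m0 (fun i => - u i)) (m0 (fun i => - v i))).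
have fm (w : I -> R) sw := ge0_fin_esum (m0 w) sw.
by rewrite !fineD ?fm// /Ssum; lra.
Qed.

Lemma rsumZ (a : R) u : summable A (EFin \o u) ->
  rsum A (fun i => a * u i) = a * rsum A u.
Proof.
move=> su; have suN : summable A (EFin \o (fun i => - u i)).
  by move: su; rewrite summableN.
have m0 (w : I -> R) i : 0 <= Num.max (w i) 0 by rewrite le_max lexx orbT.
have M := summable_max0 su; have MN := summable_max0 suN.
have Z b (w : I -> R) : 0 < b -> (forall i, 0 <= w i) ->
    summable A (EFin \o w) ->
    fine (\esum_(i in A) (b * w i)%:E)%E = b * fine (\esum_(i in A) (w i)%:E)%E.
  move=> b0 w0 sw; rewrite -[X in fine X]/(Ssum (fun i => b * w i)) SsumZ//.
  by rewrite fineM// ge0_fin_esum.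
have [a0|a0|<-] := ltgtP 0 a.
- rewrite (@rsum_posneg _ (fun i => a * Num.max (u i) 0)
     (fun i => a * Num.max (- u i) 0)) //.
  + by rewrite (Z _ _ a0 (m0 u) M) (Z _ _ a0 (m0 (fun i => - u i)) MN) -mulrBr.
  + by move=> i; apply: mulr_ge0; [exact: ltW|exact: (m0 u)].
  + by move=> i; apply: mulr_ge0; [exact: ltW|exact: (m0 (fun i => - u i))].
  + exact: summableZ.
  + exact: summableZ.
  + exact: summableZ.
  + by move=> i _; rewrite -mulrBr; congr (_ * _);
      case: (leP (u i) 0); case: (leP (- u i) 0); lra.
- have na : 0 < - a by rewrite oppr_gt0.
  rewrite (@rsum_posneg _ (fun i => - a * Num.max (- u i) 0)
     (fun i => - a * Num.max (u i) 0)) //.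
  + by rewrite (Z _ _ na (m0 u) M) (Z _ _ na (m0 (fun i => - u i)) MN) -mulrBr
      mulNr -mulrN opprB.
  + by move=> i; apply: mulr_ge0; [exact: ltW|exact: (m0 (fun i => - u i))].
  + by move=> i; apply: mulr_ge0; [exact: ltW|exact: (m0 u)].
  + exact: summableZ.
  + exact: summableZ.
  + exact: summableZ.
  + by move=> i _; rewrite -mulrBr mulNr -mulrN opprB; congr (_ * _);
      case: (leP (u i) 0); case: (leP (- u i) 0); lra.
- rewrite mul0r /rsum !esum1 ?subrr// => i _.
  + by rewrite mul0r oppr0 maxxx.
  + by rewrite mul0r maxxx.
Qed.

End UnorderedSums.

Section RsumCongruence.
Context (R : realType) (I : choiceType) (A : set I).
Implicit Types (u v : I -> R).

Lemma eq_rsum u v : (forall i, A i -> u i = v i) -> rsum A u = rsum A v.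
Proof.
by move=> uv; rewrite /rsum; congr (fine _ - fine _);
  apply: eq_esum => i /uv ->.
Qed.

Lemma rsum0 u : (forall i, A i -> u i = 0) -> rsum A u = 0.
Proof.
by move=> u0; rewrite /rsum !esum1 ?subrr// => i /u0 ->; rewrite ?oppr0 maxxx.
Qed.

End RsumCongruence.

(** * Survivor sets and the transfer operators *)

Lemma cocycleSr (I Y : Type) (s : I -> I) (A : I -> Y -> Y) n w y :
  cocycle s A n.+1 w y = cocycle s A n (s w) (A w y).
Proof. by elim: n => //= n <-; rewrite -iterSr. Qed.

Section System.
Context (R : realType) d (Om : measurableType d) (m : probability Om R)
  (X : completePseudoMetricType R) (S : random_system Om X).
Hypotheses (hclosed : closed_system m S) (hopen : open_system m S).
Hypothesis (hC2 : cond_C2 m S).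
Implicit Types (w : Om) (e N k n j l : nat) (x : X).
Local Notation sg := (sigma S).
Local Notation sgV := (sigma_inv S).
Local Notation J := (fib S).

(** Unlike [survivor], indexed by the number of times at which the hole is
    avoided, so that the whole fibre is the case [n = 0]. *)
Definition surv N n w : set X := [set x | J w x /\
  forall j, (j < n)%N -> ~ hole S N (iter j sg w) (tmap_iter S j w x)].

Definition pull (E : Om -> set X) w : set X :=
  [set x | J w x /\ E (sg w) (tmap S w x)].

Definition hit_at N n w : set X :=
  [set x | J w x /\ hole S N (iter n sg w) (tmap_iter S n w x)].

Definition first_hit N n w : set X := surv N n w `\` surv N n.+1 w.

Lemma survivorE N n w : survivor S n N w = surv N n.+1 w.
Proof. by []. Qed.

Lemma surv0 N w : surv N 0 w = J w.
Proof. by apply/seteqP; split => x; [case|]. Qed.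

Lemma hole_fib N w x : hole S N w x -> J w x.
Proof. by case: N => //= N []. Qed.

Lemma tmap_iterSr n w x :
  tmap_iter S n.+1 w x = tmap_iter S n (sg w) (tmap S w x).
Proof. exact: cocycleSr. Qed.

Lemma survS N n w : surv N n.+1 w = pull (surv N n) w `\` hole S N w.
Proof.
apply/seteqP; split => x /=.
  move=> [Jx h]; split; last exact: (h 0%N).
  split => //; split; first exact: (tmap_fib hclosed).
  by move=> j jn; rewrite -iterSr -tmap_iterSr; exact: h.
move=> [[Jx [_ h]] h0]; split => // -[|j] jn //.
by rewrite iterSr tmap_iterSr; exact: h.
Qed.

Lemma first_hitE N n w x :
  first_hit N n w x <-> surv N n w x /\ hit_at N n w x.
Proof.
split => [[[Jx h] /not_andP[//|/existsNP[j /not_implyP[jn /contrapT hj]]]]|].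
  split; split => //; move: jn; rewrite ltnS leq_eqVlt => /predU1P[<-//|jn].
  by have := h j jn.
move=> [sx [Jx hx]]; split => // -[_ /(_ n (ltnSn n))]; exact.
Qed.

Lemma hit_atS N n w : hit_at N n.+1 w = pull (hit_at N n) w.
Proof.
apply/seteqP; split => x [Jx].
  rewrite iterSr tmap_iterSr => hx.
  by split => //; split => //; exact: (tmap_fib hclosed).
by move=> [_ hx]; split => //; rewrite iterSr tmap_iterSr.
Qed.

Lemma hit_at0 N w : hit_at N 0 w = hole S N w.
Proof.
by apply/seteqP; split => x; [case|move=> hx; split => //; exact: hole_fib hx].
Qed.

Lemma first_hitS N n w :
  first_hit N n.+1 w = pull (first_hit N n) w `\` hole S N w.
Proof.
rewrite /first_hit !survS; apply/seteqP; split => x /=.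
  move=> [[[Jx sx] hx] nx]; split => //; split => //; split => // s2.
  by apply: nx.
by move=> [[Jx [sx nx]] hx]; split => //; case=> -[_ s2] _; exact: nx.
Qed.

(** Measurability of a family of subsets of the fibres, relative to the graph,
    which need not be measurable itself. It passes to fibres because these are
    closed, and to preimages because [tmap] maps fibres into fibres. *)
Definition gmeasurable (E : Om -> set X) :=
  strace measurable (graph S) [set p | E p.1 p.2].

Lemma gmeasurable_fib E w x : gmeasurable E -> E w x -> J w x.
Proof.
move=> [B _ BE] Ex; have : [set p : Om * borel X | E p.1 p.2] (w, x) by [].
by rewrite -BE => -[].
Qed.

Lemma measurable_fib w : measurable (J w : set (borel X)).
Proof.
rewrite -[J w]setCK; apply: measurableC; apply: sub_sigma_algebra.
exact/closed_openC/(fib_closed hclosed).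
Qed.

Lemma gmeasurable_section E w : gmeasurable E ->
  measurable (E w : set (borel X)).
Proof.
move=> [B mB BE].
have -> : E w = xsection B w `&` J w.
  apply/seteqP; split => x.
    move=> Ex; have : [set p : Om * borel X | E p.1 p.2] (w, x) by [].
    by rewrite -BE => -[Bx Jx]; split => //; apply/xsectionP.
  move=> [/xsectionP Bx Jx].
  have : (B `&` graph S) (w, x) by [].
  by rewrite BE.
apply: measurableI; last exact: measurable_fib.
exact: measurable_xsection.
Qed.

Lemma gmeasurable_graph : gmeasurable J.
Proof. by exists setT => //; rewrite setTI. Qed.

Lemma gmeasurableD E F : gmeasurable E -> gmeasurable F ->
  gmeasurable (fun w => E w `\` F w).
Proof.
move=> [B mB BE] [C mC CF]; exists (B `\` C); first exact: measurableD.
have -> : [set p : Om * borel X | (E p.1 `\` F p.1) p.2] =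
  [set p : Om * borel X | E p.1 p.2] `\` [set p : Om * borel X | F p.1 p.2] by [].
rewrite -BE -CF; apply/seteqP; split => p /=.
  by move=> [[Bp Cp] gp]; split => // -[].
by move=> [[Bp gp] Cp]; split => //; split => // ?; exact: Cp.
Qed.

Lemma gmeasurable_pull E : gmeasurable E -> gmeasurable (pull E).
Proof.
move=> [B mB BE].
have [C mC CB] := measurable_skew hclosed mB; exists C => //.
rewrite CB; apply/seteqP; split => -[w x] /= [gx].
  move=> Bx; split => //.
  have : (B `&` graph S) (Defs.skew S (w, x)).
    by split => //; exact: (tmap_fib hclosed).
  by rewrite BE.
move=> Ex; split => //.
have : [set p : Om * borel X | E p.1 p.2] (Defs.skew S (w, x)) by [].
by rewrite -BE => -[].
Qed.

Lemma gmeasurable_hole N : gmeasurable (hole S N).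
Proof.
case: N => [|N]; last exact: (hole_measurable hopen).
by exists set0 => //; rewrite set0I; apply/seteqP; split.
Qed.

Lemma gmeasurable_surv N n : gmeasurable (surv N n).
Proof.
elim: n => [|n IH].
  rewrite (_ : surv N 0 = J); first exact: gmeasurable_graph.
  by apply/funext => w; exact: surv0.
rewrite (_ : surv N n.+1 = fun w => pull (surv N n) w `\` hole S N w).
  by apply: gmeasurableD; [exact: gmeasurable_pull|exact: gmeasurable_hole].
by apply/funext => w; exact: survS.
Qed.

Lemma gmeasurable_hit_at N n : gmeasurable (hit_at N n).
Proof.
elim: n => [|n IH].
  rewrite (_ : hit_at N 0 = hole S N); first exact: gmeasurable_hole.
  by apply/funext => w; exact: hit_at0.
rewrite (_ : hit_at N n.+1 = pull (hit_at N n)); first exact: gmeasurable_pull.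
by apply/funext => w; exact: hit_atS.
Qed.

Lemma gmeasurable_first_hit N n : gmeasurable (first_hit N n).
Proof. by apply: gmeasurableD; exact: gmeasurable_surv. Qed.

Lemma bspace_fib w f x : bspace S w f -> ~ J w x -> f x = 0.
Proof.
have [V [ev [_ _ <- _ ev0]]] := bspace_banach hclosed w.
by move=> [u _ <-]; exact: ev0.
Qed.

Lemma open_transfer_iter_bspace N n w f : bspace S w f ->
  bspace S (iter n sg w) (open_transfer_iter S N n w f).
Proof.
by move=> fB; elim: n => //= n; exact: (open_transfer_bspace hopen).
Qed.

Lemma open_transfer_lin N w (a b : R) f g : bspace S w f -> bspace S w g ->
  open_transfer S N w (fun y => a * f y + b * g y) =
  fun x => a * open_transfer S N w f x + b * open_transfer S N w g x.
Proof.
move=> fB gB; apply/funext => x; rewrite /open_transfer /transfer.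
set A := [set y | _].
set u := fun h y => \1_(J w `\` hole S N w) y * h y * weight S w y.
have su h : bspace S w h -> summable A (EFin \o u h).
  move=> hB; apply: le_lt_trans (transfer_summable hclosed hB x).
  apply: le_esum => y _; rewrite /= lee_fin /u -mulrA normrM.
  by rewrite ler_piMl// indicE; case: (_ \in _); rewrite ?normr1 ?normr0.
rewrite -(rsumZ a (su f fB)) -(rsumZ b (su g gB)) -rsumD.
- by apply: eq_rsum => y _; rewrite /u; ring.
- exact/summableZ/su.
- exact/summableZ/su.
Qed.

(** Avoiding the hole at [n + 1] times means avoiding it now and at [n] times
    from the image point on; the second condition is constant on the preimages
    of a point and so leaves the sum over them. *)
Lemma transfer_surv N n w f :
  transfer S w (fun x => \1_(surv N n.+1 w) x * f x) =
  fun x => \1_(surv N n (sg w)) x * open_transfer S N w f x.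
Proof.
apply/funext => x; rewrite survS /open_transfer /transfer.
have [sx|sx] := pselect (surv N n (sg w) x).
  rewrite [X in X * _]indicE mem_set// mul1r; apply: eq_rsum => y [Jy Ty].
  congr (_ * _ * _); rewrite !indicE; congr (_%:R); congr nat_of_bool.
  apply/idP/idP; rewrite !inE => -[h1 h2]; split => //.
  by split => //; rewrite Ty.
rewrite [X in _ = X * _]indicE memNset// mul0r; apply: rsum0 => y [Jy Ty].
rewrite indicE memNset ?mul0r// => -[[_ +] _].
by rewrite Ty.
Qed.

Lemma conformal_surv1 N n w f : bspace S w f ->
  lam S 0 w * nu_int S 0 w (fun x => \1_(surv N n.+1 w) x * f x) =
  nu_int S 0 (sg w) (fun x => \1_(surv N n (sg w)) x * open_transfer S N w f x).
Proof.
move=> fB; rewrite -(nu0_conformal_truncated hopen N n fB).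
by rewrite survivorE transfer_surv.
Qed.

Definition lamn e n w := \prod_(j < n) lam S e (iter j sg w).

Lemma lamnS e n w : lamn e n.+1 w = lamn e n w * lam S e (iter n sg w).
Proof. by rewrite /lamn big_ord_recr. Qed.

(** Survival probabilities in terms of the open operators, with [l] further
    avoidance times kept aside on the target fibre. *)
Lemma conformal_surv N n l w f : bspace S w f ->
  lamn 0 n w * nu_int S 0 w (fun x => \1_(surv N (n + l) w) x * f x) =
  nu_int S 0 (iter n sg w) (fun x =>
    \1_(surv N l (iter n sg w)) x * open_transfer_iter S N n w f x).
Proof.
move=> fB; elim: n l => [|n IH] l; first by rewrite /lamn big_ord0 mul1r.
rewrite lamnS mulrAC addSnnS IH mulrC.
by rewrite conformal_surv1//; exact: open_transfer_iter_bspace.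
Qed.

Lemma nu_integrable e w f : bspace S w f ->
  (nu S e w).-integrable [set: borel X] (EFin \o f).
Proof. exact: (C2_integrable hC2). Qed.

Lemma nu_int_indic e w f (A : set (borel X)) :
  nu_int S e w (fun x => \1_A x * f x) = \int[nu S e w]_(x in A) f x.
Proof.
rewrite Rintegral_mkcond /nu_int; apply: eq_Rintegral => x _.
by rewrite patchE indicE; case: (_ \in _); rewrite (mul1r, mul0r).
Qed.

Lemma mu_Rintegral w (A : set (borel X)) : measurable A ->
  mu S w A = (\int[nu S 0 w]_(x in A) phi S 0 w x)%:E.
Proof.
move=> mA; rewrite /mu /Rintegral fineK//; apply: integrable_fin_num => //.
apply: (integrableS measurableT) => //.
exact/nu_integrable/(phi0_bspace hclosed).
Qed.

End System.

(** * Invariance of the fibre measures *)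

Section DensityMeasure.
Context d (T : measurableType d) (R : realType) (mu : {measure set T -> \bar R}).
Variable (f : T -> \bar R).
Hypotheses (mf : measurable_fun [set: T] f) (f0 : forall x, (0 <= f x)%E).

Lemma exists_density_measure :
  exists mf : {measure set T -> \bar R},
    forall A, mf A = (\int[mu]_(x in A) f x)%E.
Proof.
pose k (A : set T) := (\int[mu]_(x in A) f x)%E.
have k0 : k set0 = 0%E by rewrite /k integral_set0.
have kge0 A : (0 <= k A)%E by apply: integral_ge0.
have ksa : semi_sigma_additive k.
  move=> F mF tF mUF; rewrite /k ge0_integral_bigcup//.
    by apply: is_cvg_ereal_nneg_natsum => n _; exact: kge0.
  exact: measurable_funTS.
pose K : {measure set T -> \bar R} :=
  HB.pack k (isMeasure.Build _ _ _ k k0 kge0 ksa).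
by exists K.
Qed.

End DensityMeasure.

Section SectionMeasurability.
Context d d' (X : measurableType d) (Y : measurableType d') (R : realType).
Variable (k : X -> set Y -> \bar R).

(** Finiteness of each measure, without a bound uniform in [x], suffices: the
    Dynkin argument subtracts measures within one section at a time. *)
Lemma measurable_fun_xsection_measures :
  (forall x, exists2 mx : {measure set Y -> \bar R}, k x = mx & (mx setT < +oo)%E) ->
  (forall A, measurable A -> measurable_fun [set: X] (k ^~ A)) ->
  forall B : set (X * Y), measurable B ->
    measurable_fun [set: X] (fun x => k x (xsection B x)).
Proof.
move=> kmx mk B mB.
pose K x : {measure set Y -> \bar R} := sval (cid2 (kmx x)).
have kK x : k x = K x by rewrite /K; case: cid2.
have Kfin x : (K x setT < +oo)%E by rewrite /K; case: cid2.
have mK U : measurable U -> measurable_fun [set: X] (K ^~ U).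
  move=> mU; rewrite (_ : K ^~ U = k ^~ U); first exact: mk.
  by apply/funext => x; rewrite kK.
pose K' : R.-ker X ~> Y := HB.pack K (isKernel.Build _ _ X Y R K mK).
have := @measurable_prod_subset_xsection_kernel _ _ X Y R K' setT measurableT.
move=> /(_ _ B mB) [].
  move=> x; exists (fine (K x setT) + 1) => A mA.
  rewrite /= /mrestr setIT EFinD fineK; last by rewrite ge0_fin_numE.
  apply: (@le_lt_trans _ _ (K x setT)); first by rewrite le_measure// inE.
  by rewrite lteDl// ge0_fin_numE.
move=> _; rewrite (_ : (fun x => k x _) =
  (fun x => mrestr (K' x) measurableT (xsection B x)))//.
by apply/funext => x; rewrite /mrestr setIT kK.
Qed.

End SectionMeasurability.

Section FibreInvariance.
Context (R : realType) d (Om : measurableType d) (m : probability Om R)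
  (X : completePseudoMetricType R) (S : random_system Om X).
Hypotheses (hclosed : closed_system m S) (hC2 : cond_C2 m S).
Local Notation sg := (sigma S).
Local Notation sgV := (sigma_inv S).
Local Notation J := (fib S).

Lemma phi0_ge0 w x : 0 <= phi S 0 w x.
Proof.
have [Jx|Jx] := pselect (J w x); first exact/ltW/(phi0_gt0 hclosed).
by rewrite (bspace_fib hclosed (phi0_bspace hclosed w)).
Qed.

Lemma phi0_measurable_fib w : measurable_fun [set: borel X] (phi S 0 w : borel X -> R).
Proof.
by have /measurable_int/measurable_EFinP := nu_integrable hC2 0 (phi0_bspace hclosed w).
Qed.

Lemma mu_fib w (A : set X) : mu S w (A `&` J w) = mu S w A.
Proof.
rewrite /mu integral_mkcond [RHS]integral_mkcond; apply: eq_integral => x _.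
rewrite !patchE in_setI; case: (_ \in A) => //=.
case: ifPn => //; rewrite notin_setE => Jx.
by rewrite (bspace_fib hclosed (phi0_bspace hclosed w)).
Qed.

Lemma exists_mu_measure w :
  exists2 mx : {measure set (borel X) -> \bar R}, mu S w = mx & (mx setT < +oo)%E.
Proof.
have [||mx mxE] := @exists_density_measure _ (borel X) R (nu S 0 w)
  (fun x => (phi S 0 w x)%:E).
- apply/measurable_EFinP; exact: phi0_measurable_fib.
- by move=> x; rewrite lee_fin phi0_ge0.
exists mx; first by apply/funext => A; rewrite mxE.
rewrite mxE; apply: integrable_lty => //.
exact/(nu_integrable hC2)/(phi0_bspace hclosed).
Qed.

Lemma mu_set0 w : mu S w set0 = 0%E.
Proof. by rewrite /mu integral_set0. Qed.

Lemma mu_ge0 w A : (0 <= mu S w A)%E.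
Proof. by apply: integral_ge0 => x _; rewrite lee_fin phi0_ge0. Qed.

Lemma measurable_mu_section E : gmeasurable S E ->
  measurable_fun [set: Om] (fun w => mu S w (E w)).
Proof.
move=> [B mB BE].
rewrite (_ : (fun w => _) = (fun w => mu S w (xsection B w))).
  apply: measurable_fun_xsection_measures => //; first exact: exists_mu_measure.
  by have [[hm _] _] := mu0_random hclosed; exact: hm.
apply/funext => w; rewrite -[RHS]mu_fib; congr (mu S w _).
apply/seteqP; split => x.
  move=> Ex; have : [set p : Om * borel X | E p.1 p.2] (w, x) by [].
  by rewrite -BE => -[Bx Jx]; split => //; apply/xsectionP.
move=> [/xsectionP Bx Jx].
have : (B `&` graph S) (w, x) by [].
by rewrite BE.
Qed.

(** Invariance of the global measure, tested on the part of a set lying over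
    a measurable set of base points, localizes to almost every fibre. *)
Lemma fibre_invariance E : gmeasurable S E ->
  {ae m, forall w, mu S w (pull S E w) = mu S (sg w) (E (sg w))}.
Proof.
move=> gE; have gpE := gmeasurable_pull hclosed gE.
have mF := measurable_mu_section gpE; have mG := measurable_mu_section gE.
have msg := measurable_sigma hclosed.
have mu1 : {ae m, forall w, mu S w setT = 1%E} by case: (mu0_random hclosed).
have le_mu w (A : set X) : measurable (A : set (borel X)) -> (mu S w A <= mu S w setT)%E.
  have [mx -> _] := exists_mu_measure w => mA.
  by rewrite le_measure// inE.
have h : {ae m, forall w, setT w -> mu S w (pull S E w) = mu S (sg w) (E (sg w))}.
  apply: (@integral_ae_eq _ _ _ m setT measurableT
    (fun w => mu S (sg w) (E (sg w))) (fun w => mu S w (pull S E w))).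
  - apply/integrableP; split => //.
    apply: (@le_lt_trans _ _ (\int[m]_w (cst 1 w))%E).
      apply: ae_ge0_le_integral => //; first exact: measurableT_comp.
      apply: filterS mu1 => w w1 _; rewrite gee0_abs ?mu_ge0// /cst -w1.
      exact: (le_mu _ _ (gmeasurable_section hclosed w gpE)).
    by rewrite integral_cst// [X in (_ * X)%E]probability_setT mule1 ltry.
  - exact: (measurableT_comp mG msg).
  move=> D _ mD; pose A := sgV @^-1` D.
  have mA : measurable A.
    by rewrite /A -[X in measurable X]setTI; exact: (measurable_sigma_inv hclosed).
  have DA : D = sg @^-1` A.
    by apply/seteqP; split => w; rewrite /A /= (sigmaK hclosed).
  have [B mB BE] := gE.
  have BEP w x : J w x -> B (w, x) <-> E w x.
    move=> Jx; have := congr1 (fun K => K (w, x)) BE => /= <-.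
    by split => [|[]].
  pose E' := B `&` (A `*` setT).
  have mE' : measurable E'.
    by apply: measurableI => //; exact: measurableX.
  have := mu0_invariant hclosed mE'.
  rewrite /rmeasure => inv.
  transitivity (\int[m]_(w in A) mu S w (E w))%E.
    rewrite integral_mkcond [RHS]integral_mkcond.
    transitivity (\int[m]_w mu S w (xsection (graph S `&` Defs.skew S @^-1` E') w))%E.
      apply: eq_integral => w _; rewrite patchE; case: ifPn.
        rewrite inE => Dw; congr (mu S w _); apply/seteqP; split => x.
          move=> [Jx Ex]; apply/xsectionP; split; first exact: Jx.
          split; last by split; [move: Dw; rewrite DA; exact|exact: I].
          exact: (BEP _ _ (tmap_fib hclosed Jx)).2.
        move=> /xsectionP[Jx [Bx _]]; split; first exact: Jx.
        exact: (BEP _ _ (tmap_fib hclosed Jx)).1.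
      rewrite notin_setE => Dw; rewrite -[LHS](mu_set0 w); congr (mu S w _).
      apply/seteqP; split => x; first by case.
      by move=> /xsectionP[_ [_ [Aw _]]]; apply: Dw; rewrite DA.
    rewrite inv; apply: eq_integral => w _; rewrite patchE; case: ifPn.
      rewrite inE => Aw; congr (mu S w _); apply/seteqP; split => x.
        by move=> /xsectionP[Jx [Bx _]]; exact: (BEP _ _ Jx).1.
      move=> Ex; have Jx := gmeasurable_fib gE Ex.
      apply/xsectionP; split; first exact: Jx.
      split; first exact: (BEP _ _ Jx).2.
      split; [exact: Aw|exact: I].
    rewrite notin_setE => Aw; rewrite -[RHS](mu_set0 w); congr (mu S w _).
    apply/seteqP; split => x; last by case.
    by move=> /xsectionP[_ [_ [Aw' _]]]; case: (Aw Aw').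
  rewrite [in RHS]DA; apply/esym.
  exact: (ge0_integral_preserving msg (sigma_preserving hclosed) mA mG
    (fun w => mu_ge0 w (E w))).
by apply: filterS h => w; exact.
Qed.

End FibreInvariance.

(** * Estimates along a good orbit *)

Section Estimates.
Context (R : realType) d (Om : measurableType d) (m : probability Om R)
  (X : completePseudoMetricType R) (S : random_system Om X).
Hypotheses (hclosed : closed_system m S) (hopen : open_system m S).
Hypothesis (hC2 : cond_C2 m S).
Hypothesis (Qop_bspace : forall e w f,
  bspace S w f -> bspace S (sigma S w) (Qop S e w f)).
Variables (C2 C3 D T : R) (alpha : nat -> R).
Implicit Types (w : Om) (e N k n j l : nat) (x : X).
Local Notation sg := (sigma S).
Local Notation sgV := (sigma_inv S).
Local Notation J := (fib S).
Local Notation intg w A f := (Rintegral (nu S 0 w) (A : set (borel X)) f).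

(** What has to hold at every point of an orbit. Each clause holds almost
    everywhere, hence so along whole orbits; the clauses on [pull] are the
    instances of fibre invariance that are used. [C2] and [C3] bound the
    eigenfunctions, [D * alpha] bounds the remainder of the spectral
    decomposition of [phi_0], and [T / N] the measure of the hole. *)
Record good_fibre w : Prop := GoodFibre {
  good_nu_mass : nu S 0 w setT = 1%E;
  good_mu_mass : mu S w setT = 1%E;
  good_norm : forall e, nu_int S 0 w (phi S e w) = 1;
  good_split : forall e f, bspace S w f -> forall x,
    (lam S e w)^-1 * open_transfer S e w f x =
    nu_int S e w f * phi S e (sg w) x + Qop S e w f x;
  good_Q_nu : forall e f, bspace S w f -> nu_int S e (sg w) (Qop S e w f) = 0;
  good_decay : forall e n, (0 < n)%N ->
    (Linfty_norm S (iter n sg w) (Qop_iter S e n w (phi S 0 w)) <=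
      (D * alpha n)%:E)%E;
  good_phi_bound : forall e, (Linfty_norm S w (phi S e w) <= C2%:E)%E;
  good_phi0_ge : forall x, J w x -> C3^-1 <= phi S 0 w x;
  good_hole_bound : forall N, (0 < N)%N -> (mu S w (hole S N w) <= (T / N%:R)%:E)%E;
  good_pull_first_hit : forall N k,
    mu S w (pull S (first_hit S N k) w) = mu S (sg w) (first_hit S N k (sg w));
  good_pull_hit_at : forall N k,
    mu S w (pull S (hit_at S N k) w) = mu S (sg w) (hit_at S N k (sg w))
}.

(** Relative drop of the leading eigenvalue when the hole is opened. *)
Definition lam_drop N w : R := 1 - lam S N w / lam S 0 w.
Definition lam_drop_prod N n w : R := \prod_(j < n) (1 - lam_drop N (iter j sg w)).
Definition nu_phi0 N w : R := nu_int S N w (phi S 0 w).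

Lemma lam_gt0 e w : 0 < lam S e w.
Proof. exact: (C2_lam_gt0 hC2). Qed.

Lemma lamn_gt0 e n w : 0 < lamn S e n w.
Proof. by apply: prodr_gt0 => j _; exact: lam_gt0. Qed.

Lemma lam_drop_prodE N n w : lam_drop_prod N n w = lamn S N n w / lamn S 0 n w.
Proof.
rewrite /lam_drop_prod /lamn -prodf_div; apply: eq_bigr => j _.
by rewrite /lam_drop subKr.
Qed.

Lemma intg_integrable e w f (A : set (borel X)) : bspace S w f -> measurable A ->
  (nu S e w).-integrable A (EFin \o f).
Proof.
move=> fB mA; apply: (integrableS measurableT) => //.
exact: (nu_integrable hC2).
Qed.

Lemma intg_fib w f : bspace S w f -> intg w (J w) f = nu_int S 0 w f.
Proof.
move=> fB; rewrite Rintegral_mkcond; apply: eq_Rintegral => x _.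
rewrite patchE; case: ifPn => //; rewrite notin_setE => Jx.
by rewrite (bspace_fib hclosed fB).
Qed.

Lemma intg_setD w f (A B : set (borel X)) : bspace S w f ->
  measurable A -> measurable B -> B `<=` A ->
  intg w (A `\` B) f = intg w A f - intg w B f.
Proof.
move=> fB mA mB BA; apply/eqP; rewrite eq_sym subr_eq; apply/eqP.
rewrite -Rintegral_setU//.
- by rewrite setUC setDUK.
- exact: measurableD.
- by apply: intg_integrable => //; apply: measurableU => //; exact: measurableD.
- by apply/disj_setPS => x [[_ nB] /nB].
Qed.

Lemma intg_le_Linfty w f (A : set (borel X)) (c : R) : nu S 0 w setT = 1%E ->
  bspace S w f -> measurable A -> (Linfty_norm S w f <= c%:E)%E ->
  `|intg w A f| <= c * fine (nu S 0 w A).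
Proof.
move=> nu1 fB mA.
rewrite /Linfty_norm unlock [X in (if (0 < X)%E then _ else _)]nu1 lte01.
move=> /ess_supP fc.
have intf := intg_integrable 0 fB mA.
apply: (le_trans (le_normr_Rintegral mA intf)).
have nuA : (nu S 0 w A < +oo)%E.
  by apply: (@le_lt_trans _ _ (nu S 0 w setT)); rewrite ?le_measure ?inE// nu1 ltry.
have fA : nu S 0 w A \is a fin_num.
  rewrite ge0_fin_numE; [exact: nuA|exact: measure_ge0].
rewrite -lee_fin EFinM (fineK fA).
rewrite -integral_cst//.
rewrite /Rintegral fineK; last first.
  by apply: integrable_fin_num => //; exact: integrable_norm intf.
have c0 : 0 <= c.
  rewrite leNgt; apply/negP => c0; have [Z [mZ Z0 Zc]] := fc.
  have : (nu S 0 w setT <= nu S 0 w Z)%E.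
    rewrite le_measure ?inE// => x _; apply: Zc => /=; rewrite lee_fin => h.
    by have := le_lt_trans (normr_ge0 (f x)) (le_lt_trans h c0); rewrite ltxx.
  by rewrite nu1 Z0 lee_fin ler10.
apply: ae_ge0_le_integral => //.
- apply/measurable_EFinP; apply: measurableT_comp => //.
  by apply/measurable_EFinP; exact: (measurable_int _ intf).
- by apply: filterS fc => x fx _; exact: fx.
Qed.


Lemma mu_intg w (A : set (borel X)) : measurable A ->
  mu S w A = (intg w A (phi S 0 w))%:E.
Proof. by move=> mA; rewrite (mu_Rintegral hclosed hC2). Qed.

Lemma measurable_hole N w : measurable (hole S N w : set (borel X)).
Proof. exact: (gmeasurable_section hclosed w (gmeasurable_hole hopen N)). Qed.

Lemma measurable_surv N n w : measurable (surv S N n w : set (borel X)).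
Proof. exact: (gmeasurable_section hclosed w (gmeasurable_surv hclosed hopen N n)). Qed.

Lemma surv1 N w : surv S N 1 w = J w `\` hole S N w.
Proof.
rewrite (survS hclosed); apply/seteqP; split => x.
  by move=> [[Jx _] hx]; split.
move=> [Jx hx]; split => //; split => //.
by rewrite surv0; exact: (tmap_fib hclosed).
Qed.

Lemma conformal_intg N n l w f : bspace S w f ->
  lamn S 0 n w * intg w (surv S N (n + l) w) f =
  intg (iter n sg w) (surv S N l (iter n sg w)) (open_transfer_iter S N n w f).
Proof.
by move=> fB; rewrite -!nu_int_indic; exact: (conformal_surv hclosed hopen).
Qed.

Lemma phi_bspace e v : bspace S v (phi S e v).
Proof. exact: (C2_phi_bspace hC2). Qed.

(** Integrate [L_N phi_N = lambda_N phi_N] against [nu_0]: conformality turns the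
    left-hand side into [lambda_0] times the integral of [phi_N] off the hole,
    and [nu_0(phi_N) = 1] in every fibre. *)
Lemma lam_dropE w N : good_fibre w -> good_fibre (sg w) ->
  lam_drop N w = intg w (hole S N w) (phi S N w).
Proof.
move=> good0 good1.
have := conformal_intg N 1 0 (phi_bspace N w).
rewrite /lamn big_ord1 /= addn0 surv0 (_ : open_transfer_iter S N 1 w _ =
    (fun x => lam S N w * phi S N (sg w) x)); last first.
  by apply/funext => x; exact: (C2_eigen hC2).
rewrite RintegralZl//; last 2 first.
- exact: (measurable_fib hclosed).
- apply: intg_integrable; last exact: (measurable_fib hclosed).
  exact: phi_bspace.
rewrite (intg_fib (phi_bspace _ _)) (good_norm good1) mulr1 surv1.
rewrite intg_setD; last 4 first.
- exact: phi_bspace.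
- exact: (measurable_fib hclosed).
- exact: measurable_hole.
- by move=> x; exact: hole_fib.
rewrite (intg_fib (phi_bspace _ _)) (good_norm good0) => h.
rewrite /lam_drop -h [X in X / _]mulrC mulfK ?gt_eqF ?lam_gt0//.
by rewrite opprB addrC subrK.
Qed.

Section GoodOrbit.
Variable w : Om.
Hypothesis good : forall n, good_fibre (iter n sg w).

(** Iterated spectral decomposition: the remainder [q] after [n + 1] steps has
    [nu_N(q) = 0], so that one more step sends it to [Q q] with no component
    along [phi_N]. *)
Lemma open_transfer_iter_split N n f : bspace S w f ->
  open_transfer_iter S N n.+1 w f = (fun x => lamn S N n.+1 w *
    (nu_int S N w f * phi S N (iter n.+1 sg w) x + Qop_iter S N n.+1 w f x)) /\
  bspace S (iter n.+1 sg w) (Qop_iter S N n.+1 w f) /\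
  nu_int S N (iter n.+1 sg w) (Qop_iter S N n.+1 w f) = 0.
Proof.
move=> fB; elim: n => [|n [IH1 [IH2 IH3]]].
  split; last by split; [exact: Qop_bspace|exact: (good_Q_nu (good 0))].
  apply/funext => x; have := good_split (good 0) N fB x.
  rewrite /lamn big_ord1 /= => <-.
  by rewrite mulrA divff ?mul1r// gt_eqF// lam_gt0.
set v := iter n.+1 sg w in IH1 IH2 IH3.
set q := Qop_iter S N n.+1 w f in IH1 IH2 IH3.
set c := nu_int S N w f in IH1 *.
split; last first.
  by split; [exact: Qop_bspace|exact: (good_Q_nu (good n.+1))].
have LB : bspace S v (open_transfer_iter S N n.+1 w f).
  exact: (open_transfer_iter_bspace hopen).
have phiB : bspace S v (phi S N v) by exact: (C2_phi_bspace hC2).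
have ln0 : lamn S N n.+1 w != 0 by rewrite gt_eqF// lamn_gt0.
have lv0 : lam S N v != 0 by rewrite gt_eqF// lam_gt0.
have qE : q = (fun y => (lamn S N n.+1 w)^-1 * open_transfer_iter S N n.+1 w f y
    + (- c) * phi S N v y).
  by apply/funext => y; rewrite IH1 mulKf// mulNr addrAC subrr add0r.
apply/funext => x.
have := good_split (good n.+1) N IH2 x.
rewrite -/v IH3 mul0r add0r [in X in X = _ -> _]qE.
rewrite (open_transfer_lin hclosed)// (C2_eigen hC2).
rewrite -[iter n.+2 sg w]/(sg v) -[Qop_iter S N n.+2 w f x]/(Qop S N v q x).
rewrite -[open_transfer_iter S N n.+2 w f x]/(open_transfer S N v
  (open_transfer_iter S N n.+1 w f) x) => <-.
rewrite lamnS -/v; field; rewrite ln0 lv0//.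
Qed.

Lemma intg_split N n (A : set (borel X)) : measurable A ->
  (lamn S N n.+1 w)^-1 *
    intg (iter n.+1 sg w) A (open_transfer_iter S N n.+1 w (phi S 0 w)) =
  nu_phi0 N w * intg (iter n.+1 sg w) A (phi S N (iter n.+1 sg w)) +
  intg (iter n.+1 sg w) A (Qop_iter S N n.+1 w (phi S 0 w)).
Proof.
move=> mA; have [-> [QB _]] := open_transfer_iter_split N n (phi_bspace 0 w).
set v := iter n.+1 sg w in QB *; set q := Qop_iter _ _ _ _ _ in QB *.
have i1 := intg_integrable 0 (phi_bspace N v) mA.
have i2 := intg_integrable 0 QB mA.
have i3 : (nu S 0 v).-integrable A
    (EFin \o (fun x => nu_int S N w (phi S 0 w) * phi S N v x)).
  exact: (integrableZl mA _ i1).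
have i4 : (nu S 0 v).-integrable A
    (EFin \o (fun x => nu_int S N w (phi S 0 w) * phi S N v x + q x)).
  exact: (integrableD mA i3 i2).
rewrite RintegralZl// mulKf ?gt_eqF ?lamn_gt0// RintegralD//.
by rewrite RintegralZl.
Qed.

(** Conformality turns the measure of the survivors into
    [nu_0(L_N^(n+1) phi_0) / lambda_0^(n+1)], to which the spectral decomposition
    applies. *)
Lemma mu_surv N n : exists2 r, `|r| <= D * alpha n.+1 &
  mu S w (surv S N n.+1 w) = (lam_drop_prod N n.+1 w * (nu_phi0 N w + r))%:E.
Proof.
set v := iter n.+1 sg w.
exists (intg v (J v) (Qop_iter S N n.+1 w (phi S 0 w))).
  have [_ [QB _]] := open_transfer_iter_split N n (phi_bspace 0 w).
  have := intg_le_Linfty (good_nu_mass (good n.+1)) QB measurableT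
    (good_decay (good 0) N (ltn0Sn n)).
  rewrite (good_nu_mass (good n.+1)) mulr1 intg_fib//.
rewrite mu_intg; last exact: measurable_surv.
congr (_%:E).
have h := intg_split N n (measurable_fib hclosed v).
have h0 := conformal_intg N n.+1 0 (phi_bspace 0 w).
rewrite -/v in h h0; rewrite addn0 surv0 in h0.
rewrite (intg_fib (phi_bspace N v)) (good_norm (good n.+1 : good_fibre v)) mulr1 in h.
rewrite lam_drop_prodE -h -h0; field.
by rewrite !gt_eqF ?lamn_gt0.
Qed.

(** The same identity with [nu_0] restricted to the hole over the last fibre;
    the coefficient of [nu_N(phi_0)] becomes the eigenvalue drop there. *)
Lemma mu_first_hit N n : let v := iter n.+1 sg w in
  exists2 r, `|r| <= D * alpha n.+1 * fine (nu S 0 v (hole S N v)) &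
  mu S w (first_hit S N n.+1 w) =
    (lam_drop_prod N n.+1 w * (nu_phi0 N w * lam_drop N v + r))%:E.
Proof.
move=> v; exists (intg v (hole S N v) (Qop_iter S N n.+1 w (phi S 0 w))).
  have [_ [QB _]] := open_transfer_iter_split N n (phi_bspace 0 w).
  exact: (intg_le_Linfty (good_nu_mass (good n.+1)) QB (measurable_hole N v)
    (good_decay (good 0) N (ltn0Sn n))).
rewrite mu_intg; last exact: (gmeasurable_section hclosed w
  (gmeasurable_first_hit hclosed hopen N n.+1)).
congr (_%:E).
rewrite /first_hit intg_setD; last 4 first.
- exact: phi_bspace.
- exact: measurable_surv.
- exact: measurable_surv.
- by move=> x [Jx h]; split => // j jn; apply: h; exact: leqW.
have h := intg_split N n (measurable_hole N v).
have h0 := conformal_intg N n.+1 0 (phi_bspace 0 w).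
have h1 := conformal_intg N n.+1 1 (phi_bspace 0 w).
rewrite -/v in h h0 h1; rewrite addn0 surv0 in h0; rewrite addn1 surv1 in h1.
have LB : bspace S v (open_transfer_iter S N n.+1 w (phi S 0 w)).
  exact: (open_transfer_iter_bspace hopen N n.+1 (phi_bspace 0 w)).
rewrite intg_setD// in h1; last 3 first.
- exact: (measurable_fib hclosed).
- exact: measurable_hole.
- by move=> x; exact: hole_fib.
rewrite -(lam_dropE N (good n.+1) (good n.+2)) in h.
rewrite lam_drop_prodE -h.
have -> : intg v (hole S N v) (open_transfer_iter S N n.+1 w (phi S 0 w)) =
  lamn S 0 n.+1 w * (intg w (surv S N n.+1 w) (phi S 0 w) -
                     intg w (surv S N n.+2 w) (phi S 0 w)).
  by rewrite mulrBr h0 h1; ring.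
field.
by rewrite !gt_eqF ?lamn_gt0.
Qed.

End GoodOrbit.

End Estimates.

(** * Limits along a good orbit *)

Section Limits.
Context (R : realType) d (Om : measurableType d) (m : probability Om R)
  (X : completePseudoMetricType R) (S : random_system Om X).
Hypotheses (hclosed : closed_system m S) (hopen : open_system m S).
Hypothesis (hC2 : cond_C2 m S).
Hypothesis (Qop_bspace : forall e w f,
  bspace S w f -> bspace S (sigma S w) (Qop S e w f)).
Variables (C2 C3 D T : R) (alpha : nat -> R).
Hypotheses (C2_ge0 : 0 <= C2) (C3_gt0 : 0 < C3) (D_ge0 : 0 <= D).
Hypothesis (alpha_ge0 : forall n, 0 <= alpha n).
Hypothesis (alpha0 : alpha n @[n --> \oo] --> 0).
Implicit Types (w : Om) (e N k n j l : nat) (x : X).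
Local Notation sg := (sigma S).
Local Notation sgV := (sigma_inv S).
Local Notation J := (fib S).
Local Notation intg w A f := (Rintegral (nu S 0 w) (A : set (borel X)) f).
Local Notation good_fibre := (good_fibre S C2 C3 D T alpha).

Definition hole_mass N w : R := fine (mu S w (hole S N w)).

Lemma mu_fin_num w A : measurable (A : set (borel X)) -> mu S w A \is a fin_num.
Proof. by move=> mA; rewrite (mu_intg hclosed hC2). Qed.

Lemma le_mu w (A B : set X) : measurable (A : set (borel X)) ->
  measurable (B : set (borel X)) -> A `<=` B -> (mu S w A <= mu S w B)%E.
Proof.
have [mx -> _] := exists_mu_measure hclosed hC2 w => mA mB AB.
by rewrite le_measure// inE.
Qed.

Lemma mu_setD w (A B : set X) : measurable (A : set (borel X)) ->
  measurable (B : set (borel X)) ->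
  fine (mu S w (A `\` B)) = fine (mu S w A) - fine (mu S w (A `&` B)).
Proof.
move=> mA mB.
have fA := mu_fin_num w mA.
have fAB := mu_fin_num w (measurableI _ _ mA mB).
have [mx mxE mxfin] := exists_mu_measure hclosed hC2 w.
rewrite mxE in fA fAB *; rewrite -fineB//; congr fine.
by apply: measureD => //; rewrite ltey_eq fA.
Qed.

Lemma hole_mass_ge0 N w : 0 <= hole_mass N w.
Proof. by apply: fine_ge0; exact: (mu_ge0 hclosed). Qed.

Lemma nu_hole_le N w : good_fibre w ->
  fine (nu S 0 w (hole S N w)) <= C3 * hole_mass N w.
Proof.
move=> good; rewrite -ler_pdivrMl// mulrC.
have mH := measurable_hole hclosed hopen N w.
rewrite /hole_mass (mu_intg hclosed hC2)//= mulrC -Rintegral_cst//.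
apply: le_Rintegral => //.
- apply: measurable_bounded_integrable => //.
    apply: (@le_lt_trans _ _ (nu S 0 w setT)); first by rewrite le_measure ?inE.
    by rewrite (good_nu_mass good) ltry.
  exists C3^-1; split; first exact: num_real.
  by move=> M CM x _ /=; rewrite gtr0_norm ?invr_gt0// ltW.
- exact: (intg_integrable hC2 0 (phi_bspace hC2 0 w) mH).
- by move=> x /hole_fib; exact: (good_phi0_ge good).
Qed.

Lemma lam_drop_le_hole_mass N w : good_fibre w -> good_fibre (sg w) ->
  `|lam_drop S N w| <= C2 * C3 * hole_mass N w.
Proof.
move=> good0 good1; rewrite (lam_dropE hclosed hopen hC2 N good0 good1).
apply: (le_trans (intg_le_Linfty hC2 (good_nu_mass good0) (phi_bspace hC2 N w)
  (measurable_hole hclosed hopen N w) (good_phi_bound good0 N))).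
by rewrite -mulrA ler_wpM2l// nu_hole_le.
Qed.

Lemma hole_mass_le N w : (0 < N)%N -> good_fibre w -> hole_mass N w <= T / N%:R.
Proof.
move=> N0 good; have h := good_hole_bound good N0; rewrite -lee_fin fineK//.
exact: (mu_fin_num w (measurable_hole hclosed hopen N w)).
Qed.

Lemma lam_drop_bound N w : (0 < N)%N -> good_fibre w -> good_fibre (sg w) ->
  `|lam_drop S N w| <= C2 * C3 * T / N%:R.
Proof.
move=> N0 good0 good1; rewrite (le_trans (lam_drop_le_hole_mass N good0 good1))//.
by rewrite -!mulrA !ler_wpM2l// ?hole_mass_le// ltW.
Qed.

Lemma lam_drop_cvg0 w : good_fibre w -> good_fibre (sg w) ->
  lam_drop S N w @[N --> \oo] --> (0 : R).
Proof.
move=> good0 good1; apply/norm_cvg0P.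
apply: (@squeeze_cvgr _ _ _ _ (cst 0) (fun N => C2 * C3 * T / N%:R)).
- near=> N; rewrite normr_ge0/= lam_drop_bound//.
  by near: N; exact: nbhs_infty_gt.
- exact: cvg_cst.
- exact: cvg_invn0.
Unshelve. all: by end_near. Qed.

Lemma mu_hit_at N n v : (forall i, good_fibre (iter i sg v)) ->
  mu S v (hit_at S N n v) = mu S (iter n sg v) (hole S N (iter n sg v)).
Proof.
elim: n v => [|n IH] v gv; first by rewrite hit_at0.
rewrite (hit_atS hclosed) (good_pull_hit_at (gv 0%N)) IH -?iterSr//.
by move=> j; rewrite -iterSr; exact: gv.
Qed.

Section ForwardOrbit.
Variable w : Om.
Hypothesis good : forall n, good_fibre (iter n sg w).

Lemma lam_drop_prod_cvg1 n : lam_drop_prod S N n w @[N --> \oo] --> (1 : R).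
Proof.
elim: n => [|n IH].
  rewrite (_ : (fun N => _) = cst 1); first exact: cvg_cst.
  by apply/funext => N; rewrite /lam_drop_prod big_ord0.
rewrite (_ : (fun N => _) =
    (fun N => lam_drop_prod S N n w * (1 - lam_drop S N (iter n sg w)))); last first.
  by apply/funext => N; rewrite /lam_drop_prod big_ord_recr.
rewrite -[X in _ --> X]mulr1; apply: cvgM => //.
rewrite -[X in _ --> X]subr0; apply: cvgB; first exact: cvg_cst.
by apply: lam_drop_cvg0; [exact: good|exact: (good n.+1)].
Unshelve. all: by end_near. Qed.

Lemma lam_drop_prod_gt0 N n : 0 < lam_drop_prod S N n w.
Proof. by rewrite lam_drop_prodE divr_gt0 ?(lamn_gt0 hC2). Qed.

Lemma mu_surv_ge N n : (0 < N)%N ->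
  1 - n%:R * (T / N%:R) <= fine (mu S w (surv S N n w)).
Proof.
move=> N0; elim: n => [|n IH].
  rewrite mul0r subr0 surv0 -[J w]setTI (mu_fib hclosed).
  by rewrite (good_mu_mass (good 0)).
have mS k := measurable_surv hclosed hopen N k w.
have mH := gmeasurable_section hclosed w (gmeasurable_hit_at hclosed hopen N n).
have mF := gmeasurable_section hclosed w
  (gmeasurable_first_hit hclosed hopen N n).
have : fine (mu S w (first_hit S N n w)) <= T / N%:R.
  apply: (le_trans _ (hole_mass_le N0 (good n))).
  rewrite /hole_mass -mu_hit_at//; apply: fine_le.
  - exact: (mu_fin_num w mF).
  - exact: mu_fin_num.
  - by apply: le_mu => // x /first_hitE[].
rewrite /first_hit mu_setD//.
rewrite (_ : surv S N n w `&` surv S N n.+1 w = surv S N n.+1 w); last first.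
  apply/setIidPr => x [Jx h]; split => // j jn; apply: h; exact: leqW.
by rewrite -natr1 mulrDl mul1r; lra.
Qed.

Lemma mu_surv_le1 N n : fine (mu S w (surv S N n w)) <= 1.
Proof.
have mS := measurable_surv hclosed hopen N n w.
rewrite -lee_fin fineK; last exact: mu_fin_num.
by rewrite -(good_mu_mass (good 0)); apply: le_mu.
Qed.

Lemma mu_surv_cvg1 n : fine (mu S w (surv S N n w)) @[N --> \oo] --> (1 : R).
Proof.
apply: (@squeeze_cvgr _ _ _ _ (fun N => 1 - n%:R * (T / N%:R)) (cst 1)).
- near=> N; rewrite mu_surv_le1 mu_surv_ge//.
  by near: N; exact: nbhs_infty_gt.
- rewrite -[X in _ --> X]subr0; apply: cvgB; first exact: cvg_cst.
  by rewrite -[X in _ --> X](mulr0 n%:R); apply: cvgMr; exact: cvg_invn0.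
- exact: cvg_cst.
Unshelve. all: by end_near. Qed.

Lemma decay_cvg0 (c : R) : c * alpha n.+1 @[n --> \oo] --> (0 : R).
Proof.
rewrite -[X in _ --> X](mulr0 c); apply: cvgMr.
by rewrite (cvg_shiftS alpha).
Qed.

(** Along finitely many steps nothing escapes as the holes shrink, so the
    spectral decomposition over [n] steps pins [nu_N(phi_0)] down to within
    the [n]-step decay. *)
Lemma nu_phi0_cvg1 : nu_phi0 S N w @[N --> \oo] --> (1 : R).
Proof.
apply: (@cvg_by_approximation _ _
  (fun n N => fine (mu S w (surv S N n.+1 w)) / lam_drop_prod S N n.+1 w) (cst 1)
  (fun n => D * alpha n.+1)).
- move=> n; near=> N.
  have [r rD ->] := mu_surv hclosed hopen hC2 Qop_bspace good N n.
  rewrite /= [X in _ - X]mulrAC divff ?gt_eqF ?lam_drop_prod_gt0// mul1r.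
  by rewrite opprD addrA subrr add0r normrN.
- move=> n; rewrite -[X in _ --> X]mulr1 -[X in _ * X]invr1.
  apply: cvgM; first exact: mu_surv_cvg1.
  by apply: cvgV; [exact: oner_neq0|exact: lam_drop_prod_cvg1].
- exact: decay_cvg0.
- exact: cvg_cst.
Unshelve. all: by end_near. Qed.

End ForwardOrbit.

Lemma iter_sigmaK i j w : iter i sg (iter (i + j) sgV w) = iter j sgV w.
Proof.
by elim: i => [//|i IH]; rewrite iterSr addSn iterS (sigma_invK hclosed).
Qed.

Lemma iter_sigma_le i k w : (i <= k)%N ->
  iter i sg (iter k sgV w) = iter (k - i) sgV w.
Proof. by move=> ik; rewrite -[in LHS](subnKC ik) iter_sigmaK. Qed.

Section BiinfiniteOrbit.
Variable w : Om.
Hypothesis good : forall n, good_fibre (iter n sg w).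
Hypothesis goodV : forall n, good_fibre (iter n sgV w).

Lemma good_back k n : good_fibre (iter n sg (iter k sgV w)).
Proof.
have [nk|kn] := leqP n k; first by rewrite iter_sigma_le.
rewrite -(subnK (ltnW kn)) iterD iter_sigma_le// subnn.
exact: good.
Qed.

Lemma qhat_num_setE N k : let v := iter k.+1 sgV w in
  [set x | [/\ J v x, hole S N w (tmap_iter S k.+1 v x),
     forall j, (1 <= j <= k)%N ->
       ~ hole S N (iter j sgV w) (tmap_iter S (k.+1 - j) v x) &
     hole S N v x]] = pull S (first_hit S N k) v `&` hole S N v.
Proof.
move=> v; have vE i : (i <= k.+1)%N -> iter i sg v = iter (k.+1 - i) sgV w.
  exact: iter_sigma_le.
apply/seteqP; split => x.
  move=> [Jx hk nh h0]; split => //; split => //; apply/first_hitE.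
  have JT := tmap_fib hclosed Jx; split; split => //.
    move=> j jk; rewrite -iterSr vE; last exact: leqW.
    rewrite -tmap_iterSr subSS.
    have := nh (k - j)%N; rewrite subn_gt0 jk leq_subr => /(_ isT).
    by rewrite subSn ?leq_subr// subKn// ltnW.
  by rewrite -iterSr vE// subnn -tmap_iterSr.
move=> [[Jx /first_hitE[[JT sx] [_ hx]]] h0]; split => //.
  by move: hx; rewrite -iterSr vE// subnn -tmap_iterSr.
move=> j /andP[j1 jk]; have kj : (k - j < k)%N.
  by rewrite ltn_subrL j1 (leq_trans j1 jk).
have := sx _ kj; rewrite -iterSr vE; last exact: leqW.
by rewrite -tmap_iterSr subSS subKn// subSn.
Qed.

Lemma qhat_den_setE N k : let v := iter k.+1 sgV w in
  [set x | J v x /\ hole S N w (tmap_iter S k.+1 v x)] = hit_at S N k.+1 v.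
Proof.
move=> v; rewrite /hit_at /v; have := iter_sigma_le w (leqnn k.+1).
by rewrite subnn => ->.
Qed.

Lemma qhatE N k : let v := iter k.+1 sgV w in
  qhat S N k w = fine (mu S v (pull S (first_hit S N k) v `&` hole S N v)) /
    hole_mass N w.
Proof.
move=> v; rewrite /qhat -/v qhat_num_setE qhat_den_setE mu_hit_at; last first.
  exact: good_back.
by rewrite iter_sigma_le// subnn.
Qed.

Definition first_hit_mass N n : R :=
  fine (mu S (iter n sgV w) (first_hit S N n (iter n sgV w))).

Lemma mu_fine_ge0 v A : 0 <= fine (mu S v A).
Proof. by apply: fine_ge0; exact: (mu_ge0 hclosed). Qed.

(** Mass that survives [n] steps and then falls into the hole over [w]: each
    step further into the past removes the orbits that had already visited the
    hole there. *)
Lemma first_hit_massE N n : 0 < hole_mass N w ->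
  first_hit_mass N n = hole_mass N w * (1 - \sum_(k < n) qhat S N k w).
Proof.
move=> H0; elim: n => [|n IH].
  rewrite big_ord0 subr0 mulr1 /first_hit_mass /first_hit /= surv0 (surv1 hclosed).
  rewrite setDD; congr (fine (mu S w _)); apply/setIidPr => x; exact: hole_fib.
set v := iter n.+1 sgV w.
have mF := gmeasurable_section hclosed v (gmeasurable_pull hclosed
  (gmeasurable_first_hit hclosed hopen N n)).
have mH := measurable_hole hclosed hopen N v.
rewrite /first_hit_mass -/v (first_hitS hclosed) mu_setD// (good_pull_first_hit (goodV n.+1)).
have -> : sg v = iter n sgV w by rewrite /v iterS (sigma_invK hclosed).
rewrite -/(first_hit_mass N n) IH big_ord_recr/= qhatE -/v.
by field; rewrite gt_eqF.
Qed.

Lemma qhat_ge0 N k : 0 <= qhat S N k w.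
Proof. by rewrite /qhat divr_ge0 ?mu_fine_ge0. Qed.

Lemma qhat_sum_le1 N n : 0 < hole_mass N w -> \sum_(k < n) qhat S N k w <= 1.
Proof.
move=> H0; have := mu_fine_ge0 (iter n sgV w) (first_hit S N n (iter n sgV w)).
by rewrite -/(first_hit_mass N n) first_hit_massE// pmulr_rge0// subr_ge0.
Qed.

Hypothesis (hole_pos : \forall N \near \oo, 0 < hole_mass N w).
Hypothesis (qhat_cvg : forall k, cvgn (fun N => qhat S N k w)).

Lemma qhat_sum_cvg n :
  \sum_(k < n) qhat S N k w @[N --> \oo] --> \sum_(k < n) qhat0 S k w.
Proof.
elim: n => [|n IH].
  rewrite big_ord0 (_ : (fun N => _) = cst 0); first exact: cvg_cst.
  by apply/funext => N; rewrite big_ord0.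
rewrite big_ord_recr (_ : (fun N => _) =
    (fun N => \sum_(k < n) qhat S N k w + qhat S N n w)); last first.
  by apply/funext => N; rewrite big_ord_recr.
by apply: cvgD => //; exact: qhat_cvg.
Qed.

Lemma theta_cvg : 1 - \sum_(k < n) qhat0 S k w @[n --> \oo] --> theta S w.
Proof.
apply: cvgB; first exact: cvg_cst.
have -> : (fun n => \sum_(k < n) qhat0 S k w) = series (fun k => qhat0 S k w).
  by apply/funext => n; rewrite seriesEord.
apply: nondecreasing_is_cvgn.
  apply: nondecreasing_series => k _ _; apply: limr_ge; first exact: qhat_cvg.
  by apply: nearW => N; exact: qhat_ge0.
exists 1 => _ [n _ <-].
rewrite -[leLHS]/(series (fun k => qhat0 S k w) n) seriesEord /=.
apply: (cvgr_to_le (@qhat_sum_cvg n)).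
by apply: filterS hole_pos => N; exact: qhat_sum_le1.
Qed.

(** Compare two expressions for the probability of a first hit at time [n + 1],
    starting [n + 1] steps in the past: the spectral one, essentially the drop
    at [w], and the combinatorial one, [hole_mass] times a partial sum of the
    series of [theta]. The remainder is of the size of the decay times
    [hole_mass], so that it is harmless after division. *)
Lemma lam_drop_over_hole_mass_cvg :
  lam_drop S N w / hole_mass N w @[N --> \oo] --> theta S w.
Proof.
pose v n := iter n.+1 sgV w.
have vK n : iter n.+1 sg (v n) = w by rewrite /v iter_sigma_le// subnn.
have gv n i : good_fibre (iter i sg (v n)) by exact: good_back.
pose ratio N := lam_drop S N w / hole_mass N w.
(* The second summand replaces the factor [nu_phi0] of the drop by its limit. *)
apply: (@cvg_by_approximation _ _
  (fun n N => (1 - \sum_(k < n.+1) qhat S N k w) / lam_drop_prod S N n.+1 (v n)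
     + ratio N * (1 - nu_phi0 S N (v n)))
  (fun n => 1 - \sum_(k < n.+1) qhat0 S k w)
  (fun n => D * C3 * alpha n.+1)).
- move=> n; near=> N.
  have H0 : 0 < hole_mass N w by near: N.
  have [r] := mu_first_hit hclosed hopen hC2 Qop_bspace (gv n) N n.
  rewrite vK => rD muE.
  have := first_hit_massE n.+1 H0; rewrite /first_hit_mass -/(v n) muE/= => h.
  have P0 := lam_drop_prod_gt0 (v n) N n.+1.
  rewrite -/(ratio N).
  rewrite (_ : ratio N - _ = - (r / hole_mass N w)); last first.
    rewrite /ratio.
    have -> : (1 - \sum_(k < n.+1) qhat S N k w) / lam_drop_prod S N n.+1 (v n) =
        (nu_phi0 S N (v n) * lam_drop S N w + r) / hole_mass N w.
      apply: (mulfI (_ : hole_mass N w * lam_drop_prod S N n.+1 (v n) != 0)).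
        by rewrite mulf_neq0 ?gt_eqF.
      transitivity (hole_mass N w * (1 - \sum_(k < n.+1) qhat S N k w)).
        by field; rewrite gt_eqF.
      by rewrite -h; field; rewrite gt_eqF.
    by field; rewrite gt_eqF.
  rewrite normrN normrM normfV (gtr0_norm H0) ler_pdivrMr//.
  rewrite (le_trans rD)//.
  rewrite (_ : D * C3 * _ * _ = D * alpha n.+1 * (C3 * hole_mass N w)); last by ring.
  by rewrite ler_wpM2l ?mulr_ge0// (nu_hole_le _ (good 0)).
- move=> n; rewrite -[X in _ --> X]addr0; apply: cvgD.
    rewrite -[X in _ --> X]mulr1 -[X in _ * X]invr1; apply: cvgM.
      by apply: cvgB; [exact: cvg_cst|exact: qhat_sum_cvg].
    by apply: cvgV; [exact: oner_neq0|exact: (lam_drop_prod_cvg1 (gv n))].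
  apply/norm_cvg0P.
  apply: (@squeeze_cvgr _ _ _ _ (cst 0)
    (fun N => C2 * C3 * `|1 - nu_phi0 S N (v n)|)).
  + near=> N; have H0 : 0 < hole_mass N w by near: N.
    rewrite normr_ge0/= normrM ler_wpM2r// /ratio normrM normfV (gtr0_norm H0).
    by rewrite ler_pdivrMr// (lam_drop_le_hole_mass N (good 0) (good 1)).
  + exact: cvg_cst.
  + rewrite -[X in _ --> X](mulr0 (C2 * C3)); apply: cvgMr.
    rewrite -[X in _ --> X](normr0 R); apply: cvg_norm.
    rewrite -[X in _ --> X](subrr (1 : R)); apply: cvgB; first exact: cvg_cst.
    exact: (nu_phi0_cvg1 (gv n)).
- exact: decay_cvg0.
- by rewrite (cvg_shiftS (fun n => 1 - \sum_(k < n) qhat0 S k w)); exact: theta_cvg.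
Unshelve. all: by end_near. Qed.

End BiinfiniteOrbit.

End Limits.

(** * The law of the hitting time *)

Section HittingLaw.
Context (R : realType) d (Om : measurableType d) (m : probability Om R)
  (X : completePseudoMetricType R) (S : random_system Om X).
Hypotheses (hclosed : closed_system m S) (hopen : open_system m S).
Hypothesis (hC2 : cond_C2 m S).
Hypothesis (Qop_bspace : forall e w f,
  bspace S w f -> bspace S (sigma S w) (Qop S e w f)).
Variables (C2 C3 D T : R) (alpha : nat -> R).
Hypotheses (C2_ge0 : 0 <= C2) (C3_gt0 : 0 < C3) (D_ge0 : 0 <= D).
Hypothesis (alpha_ge0 : forall n, 0 <= alpha n).
Hypothesis (alpha0 : alpha n @[n --> \oo] --> 0).
Local Notation sg := (sigma S).
Local Notation J := (fib S).
Local Notation good_fibre := (good_fibre S C2 C3 D T alpha).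

Lemma pull_survE N n (w : Om) x : pull S (surv S N n) w x <->
  J w x /\ forall k, (1 <= k <= n)%N -> ~ hole S N (iter k sg w) (tmap_iter S k w x).
Proof.
split=> [[Jx [_ h]]|[Jx h]]; split => //.
  by move=> [|k] //= kn; rewrite -iterS iterSr tmap_iterSr; exact: h.
split; first exact: (tmap_fib hclosed).
by move=> j jn; rewrite -iterSr -tmap_iterSr; exact: h.
Qed.

(** On the integers, [tw < tau * M] says that [tau] exceeds the integral part of
    [tw / M]. *)
Lemma hitting_time_gtE N (w : Om) (tw M : R) : 0 <= tw -> 0 < M ->
  [set x | J w x /\ (tw%:E < hitting_time S N w x * M%:E)%E] =
  pull S (surv S N (Num.truncn (tw / M))) w.
Proof.
move=> t0 M0; set p := Num.truncn _.
have tM0 : 0 <= tw / M by rewrite divr_ge0// ltW.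
have /andP[pt tp] := truncn_itv tM0; rewrite -/p in pt tp.
apply/seteqP; split => x; rewrite pull_survE => -[Jx h]; split => //.
  move=> k /andP[k1 kp] hk; move: h; apply/negP; rewrite -leNgt.
  apply: (@le_trans _ _ (k%:R%:E * M%:E)%E).
    rewrite lee_pmul2r// ?lte_fin//.
    by apply: ereal_inf_lbound; exists k.
  rewrite -EFinM lee_fin -ler_pdivlMr// (le_trans _ pt)// ler_nat//.
apply: (@lt_le_trans _ _ ((p.+1)%:R%:E * M%:E)%E).
  by rewrite -EFinM lte_fin -ltr_pdivrMr.
rewrite lee_pmul2r// ?lte_fin//.
apply: le_ereal_inf_tmp => _ [k [k1 hk] <-].
rewrite lee_fin ler_nat ltnNge; apply/negP => kp.
by apply: (h k) => //; rewrite k1 kp.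
Qed.

Variable w : Om.
Hypothesis good : forall n, good_fibre (iter n sg w).
Variables (tw : R) (xi : nat -> R) (I : R).
Hypothesis t_gt0 : 0 < tw.
Hypothesis xi0 : xi N @[N --> \oo] --> 0.
Hypothesis hole_size : forall N, (0 < N)%N ->
  mu S w (hole S N w) = ((tw + xi N) / N%:R)%:E.
Hypothesis sum_lam_drop : \sum_(j < N) lam_drop S N (iter j sg w) @[N --> \oo] --> I.

(** The event is that of surviving [p N ~ N] steps from time [1] on; it contains
    the survivors of [q N = p N + 1] times from time [0] on, and the difference
    lies in the hole over [w], of vanishing measure. *)
Lemma hitting_law :
  mu S w [set x | J w x /\ (tw%:E < hitting_time S N w x * mu S w (hole S N w))%E]
    @[N --> \oo] --> (expR (- I))%:E.
Proof.
pose M N := hole_mass S N w.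
have ME N : (0 < N)%N -> M N = (tw + xi N) / N%:R.
  by move=> N0; rewrite /M /hole_mass hole_size.
pose p N := Num.truncn (N%:R * (tw / (tw + xi N))).
have txi : tw + xi N @[N --> \oo] --> tw.
  by rewrite -[X in _ --> X]addr0; apply: cvgD => //; exact: cvg_cst.
have txi0 : \forall N \near \oo, 0 < tw + xi N by exact: (cvgr_gt _ txi).
have p1 : (p N)%:R / N%:R @[N --> \oo] --> (1 : R).
  have t0 : tw != 0 by rewrite gt_eqF.
  apply: trunc_ratio_cvg; rewrite -[X in _ --> X](divff t0).
  by apply: cvgM; [exact: cvg_cst|exact: cvgV].
pose q N := (p N).+1.
have q1 : (q N)%:R / N%:R @[N --> \oo] --> (1 : R).
  rewrite -[X in _ --> X]addr0 (_ : (fun N => _) =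
    (fun N => (p N)%:R / N%:R + 1 / N%:R)); last first.
    by apply/funext => N; rewrite /q -natr1 mulrDl.
  by apply: cvgD => //; exact: cvg_invn0.
have prod_cvg : lam_drop_prod S N (q N) w @[N --> \oo] --> expR (- I).
  apply: (prod_triangular_cvg (x := fun N j => lam_drop S N (iter j sg w))
    (K := C2 * C3 * T)) => // N j N0.
  apply: (lam_drop_bound hclosed hopen hC2 C2_ge0 C3_gt0 N0); first exact: good.
  exact: (good j.+1).
have alpha_q : alpha (q N) @[N --> \oo] --> 0.
  apply/cvgrPdist_le => e e0.
  have [n0 _ hn0] : \forall n \near \oo, `|0 - alpha n| <= e.
    by move/cvgrPdist_le : alpha0 => /(_ _ e0).
  near=> N; apply: hn0 => /=.
  have N0 : 0 < N%:R :> R by rewrite ltr0n; near: N; exact: nbhs_infty_gt.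
  have : 1 / 2 < (q N)%:R / N%:R :> R.
    by near: N; apply: (cvgr_gt _ q1); lra.
  rewrite ltr_pdivlMr// => h.
  have hN : (n0 * 2)%:R <= N%:R :> R by rewrite ler_nat; near: N; exact: nbhs_infty_ge.
  by rewrite -(ler_nat R); rewrite natrM in hN; lra.
have [r rD rE] : exists2 r : nat -> R, (forall N, `|r N| <= D * alpha (q N)) &
    forall N, mu S w (surv S N (q N) w) =
      (lam_drop_prod S N (q N) w * (nu_phi0 S N w + r N))%:E.
  pose h N := mu_surv hclosed hopen hC2 Qop_bspace good N (p N).
  exists (fun N => sval (cid2 (h N))) => N; by case: cid2.
have r0 : r N @[N --> \oo] --> (0 : R).
  apply/norm_cvg0P.
  apply: (@squeeze_cvgr _ _ _ _ (cst 0) (fun N => D * alpha (q N))).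
  - by apply: nearW => N; rewrite normr_ge0/=.
  - exact: cvg_cst.
  - by rewrite -[X in _ --> X](mulr0 D); exact: cvgMr.
have surv_cvg : fine (mu S w (surv S N (q N) w)) @[N --> \oo] --> expR (- I).
  rewrite (_ : (fun N => _) =
    (fun N => lam_drop_prod S N (q N) w * (nu_phi0 S N w + r N))); last first.
    by apply/funext => N; rewrite rE.
  rewrite -[X in _ --> X]mulr1; apply: cvgM => //.
  rewrite -[X in _ --> X]addr0; apply: cvgD => //.
  exact: (nu_phi0_cvg1 hclosed hopen hC2 Qop_bspace C2_ge0 C3_gt0 alpha0 good).
have M0 : M N @[N --> \oo] --> (0 : R).
  apply: (@squeeze_cvgr _ _ _ _ (cst 0) (fun N => T / N%:R)).
  - near=> N; rewrite (hole_mass_ge0 hclosed)/=.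
    apply: (hole_mass_le hclosed hopen hC2 _ (good 0)).
    by near: N; exact: nbhs_infty_gt.
  - exact: cvg_cst.
  - exact: cvg_invn0.
have mpull N n : measurable (pull S (surv S N n) w : set (borel X)).
  exact: (gmeasurable_section hclosed w
    (gmeasurable_pull hclosed (gmeasurable_surv hclosed hopen N n))).
have setE : \forall N \near \oo,
    [set x | J w x /\ (tw%:E < hitting_time S N w x * mu S w (hole S N w))%E] =
    pull S (surv S N (p N)) w.
  near=> N.
  have N0 : (0 < N)%N by near: N; exact: nbhs_infty_gt.
  have tx : 0 < tw + xi N by near: N.
  rewrite hole_size// hitting_time_gtE ?(ltW t_gt0)//; last first.
    by rewrite divr_gt0// ltr0n.
  congr (pull S (surv S N (Num.truncn _)) w).
  by field; rewrite gt_eqF//= pnatr_eq0 -lt0n.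
apply: cvg_EFin.
  by near=> N; rewrite (near setE N)//; exact: (mu_fin_num hclosed hC2).
apply: (@squeeze_cvgr _ _ _ _ (fun N => fine (mu S w (surv S N (q N) w)))
  (fun N => fine (mu S w (surv S N (q N) w)) + M N)) => //.
- near=> N; rewrite /= (near setE N)// /q (survS hclosed).
  have mH := measurable_hole hclosed hopen N w.
  rewrite (mu_setD hclosed hC2)//.
  have h1 := mu_fine_ge0 hclosed w (pull S (surv S N (p N)) w `&` hole S N w).
  have h2 : fine (mu S w (pull S (surv S N (p N)) w `&` hole S N w)) <= M N.
    apply: fine_le.
    - exact/(mu_fin_num hclosed hC2)/measurableI.
    - exact: (mu_fin_num hclosed hC2).
    - by apply: (le_mu hclosed hC2) => //; exact: measurableI.
  lra.
- by rewrite -[X in _ --> X]addr0; exact: cvgD.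
Unshelve. all: by end_near. Qed.

End HittingLaw.

Lemma Lfun_oo_ae_bound d (T : measurableType d) (R : realType)
    (mu : {measure set T -> \bar R}) (f : T -> R) : (0 < mu setT)%E ->
  f \in Lfun mu +oo%E -> exists c : R, {ae mu, forall x, `|f x| <= c}.
Proof.
move=> mu0 /andP[_]; rewrite inE /= /finite_norm unlock mu0 => foo.
have [y hy] : exists y : R, (ess_sup mu (abse \o (EFin \o f)) <= y%:E)%E.
  case: (ess_sup _ _) foo => [y _|//|_]; first by exists y.
  by exists 0; exact: leNye.
by exists y; move/ess_supP : hy; apply: filterS => x; rewrite lee_fin.
Qed.

(** * Almost every fibre *)

Section AlmostEveryFibre.
Context (R : realType) d (Om : measurableType d) (m : probability Om R)
  (X : completePseudoMetricType R) (S : random_system Om X).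
Hypotheses (hclosed : closed_system m S) (hopen : open_system m S).
Hypotheses (hC2 : cond_C2 m S) (hC3 : cond_C3 m S) (hC8 : cond_C8 m S).
Variables (t : Om -> R) (xi : nat -> Om -> R) (W : R).
Hypothesis (hS : cond_S m S t xi W).
Local Notation sg := (sigma S).
Local Notation sgV := (sigma_inv S).
Local Notation J := (fib S).

Lemma sigma_inv_preserving A : measurable A -> m (sgV @^-1` A) = m A.
Proof.
move=> mA; rewrite -[LHS](sigma_preserving hclosed); last first.
  by rewrite -[X in measurable X]setTI; exact: (measurable_sigma_inv hclosed).
by congr (m _); apply/seteqP; split => w; rewrite /= (sigmaK hclosed).
Qed.

Lemma ae_biinfinite_orbit (P : Om -> Prop) : {ae m, forall w, P w} ->
  {ae m, forall w, (forall n, P (iter n sg w)) /\ (forall n, P (iter n sgV w))}.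
Proof.
move=> hP.
have h1 := ae_orbit (measurable_sigma hclosed) (sigma_preserving hclosed) hP.
have h2 := ae_orbit (measurable_sigma_inv hclosed) sigma_inv_preserving hP.
by apply: filterS2 h1 h2.
Qed.

Lemma ae_hole_size : {ae m, forall w, forall N, (0 < N)%N ->
  mu S w (hole S N w) = ((t w + xi N w) / N%:R)%:E}.
Proof.
apply: ae_foralln => -[|N]; first exact: aeW.
by apply: filterS (S_hole hS (ltn0Sn N)).
Qed.

Lemma ae_good_fibre : cond_C4 m S -> cond_C5 m S -> cond_C7 m S ->
  exists (C2 C3 D T : R) (alpha : nat -> R),
    [/\ [/\ 0 <= C2, 0 < C3, 0 <= D & 0 <= T],
        forall n, 0 <= alpha n, alpha n @[n --> \oo] --> 0 &
        {ae m, forall w, good_fibre S C2 C3 D T alpha w}].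
Proof.
move=> hC4 [C2 C2_1 aeC5] [C3 C3_1 [N0 _ /(_ N0 (leqnn _)) [essC3 _]]].
have [Cf [alpha [Cf0 alpha0 alphacvg aeC4]]] := hC4 _ (phi0_bspace hclosed).
have [Mt aet] := Lfun_oo_ae_bound
  (ltac:(by rewrite probability_setT) : (0 < m setT)%E) (S_t_Linfty hS).
(* The absolute value only serves to make the constant visibly nonnegative. *)
exists C2, C3, (Cf * C2), (`|Mt + W|), alpha; split => //.
- split => //; [lra|lra|apply: mulr_ge0; lra].
- by move=> n; exact/ltW/alpha0.
- exact: cvg_series_cvg_0.
have aeC7 : {ae m, forall w, forall x, J w x -> C3^-1 <= phi S 0 w x}.
  move/ess_infP : essC3; apply: filterS => w h x Jx; rewrite -lee_fin.
  by apply: (le_trans h); apply: ereal_inf_lbound; exists x.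
have [_ ae_nu1] := nu0_random hclosed.
have [_ ae_mu1] := mu0_random hclosed.
have ae_norm := ae_foralln (C2_norm hC2).
have ae_split := ae_foralln hC3.2.
have ae_hole := ae_hole_size.
have ae_fh : {ae m, forall w, forall N k,
    mu S w (pull S (first_hit S N k) w) = mu S (sg w) (first_hit S N k (sg w))}.
  apply: ae_foralln => N; apply: ae_foralln => k.
  exact: (fibre_invariance hclosed hC2 (gmeasurable_first_hit hclosed hopen N k)).
have ae_ha : {ae m, forall w, forall N k,
    mu S w (pull S (hit_at S N k) w) = mu S (sg w) (hit_at S N k (sg w))}.
  apply: ae_foralln => N; apply: ae_foralln => k.
  exact: (fibre_invariance hclosed hC2 (gmeasurable_hit_at hclosed hopen N k)).
have ae_xi := S_xi_bound hS.
near=> w.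
have C5w : (forall e, (Linfty_norm S w (phi S e w) <= C2%:E)%E) /\
  bnorm S w (phi S 0 w) <= C2 by near: w.
have normw : forall e, nu_int S 0 w (phi S e w) = 1 /\ nu_int S 0 w \1_(J w) = 1.
  by near: w.
have splitw : forall e, [/\ forall f, bspace S w f -> forall x,
          (lam S e w)^-1 * open_transfer S e w f x =
          nu_int S e w f * phi S e (sg w) x + Qop S e w f x,
        forall x, Qop S e w (phi S e w) x = 0 &
        forall f, bspace S w f -> nu_int S e (sg w) (Qop S e w f) = 0] by near: w.
have decayw : forall n, (0 < n)%N -> forall e,
    (Linfty_norm S (iter n sg w) (Qop_iter S e n w (phi S 0 w))
     <= (Cf * alpha n * bnorm S w (phi S 0 w))%:E)%E by near: w.
have holew : forall N, (0 < N)%N ->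
    mu S w (hole S N w) = ((t w + xi N w) / N%:R)%:E by near: w.
have tw : `|t w| <= Mt by near: w.
have xiw : forall N, (0 < N)%N -> `|xi N w| <= W by near: w.
split.
- by near: w.
- by near: w.
- by move=> e; have [] := normw e.
- by move=> e f fB x; have [h _ _] := splitw e; exact: h.
- by move=> e f fB; have [_ _ h] := splitw e; exact: h.
- move=> e n n0; apply: (le_trans (decayw n n0 e)); 
  rewrite lee_fin mulrAC ler_wpM2r ?(ltW (alpha0 n))//.
  by rewrite ler_wpM2l ?(ltW Cf0)// C5w.2.
- exact: C5w.1.
- by near: w.
- move=> N N1; rewrite holew// lee_fin ler_wpM2r ?invr_ge0//.
  rewrite (le_trans _ (ler_norm _))// (le_trans (ler_norm _))//.
  by rewrite (le_trans (ler_normD _ _))// lerD// xiw.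
- by near: w.
- by near: w.
Unshelve. all: by end_near. Qed.

Lemma measurable_lam_drop N : measurable_fun [set: Om] (lam_drop S N).
Proof.
have -> : lam_drop S N = fun w => 1 - lam S N w * expR (- ln (lam S 0 w)).
  apply/funext => w; rewrite /lam_drop expRN lnK//.
  by rewrite posrE; exact: (C2_lam_gt0 hC2).
apply: measurable_funB; first exact: measurable_cst.
apply: measurable_funM; first exact: (C2_lam_measurable hC2).
apply: measurableT_comp; first exact: measurable_expR.
apply: measurableT_comp => //.
apply: measurableT_comp; first exact: measurable_ln.
exact: (C2_lam_measurable hC2).
Qed.

Lemma hole_anti (w : Om) N N' : (0 < N <= N')%N -> hole S N' w `<=` hole S N w.
Proof.
move=> NN'; have := threshold_incr hopen w NN'.
case: N N' NN' => [//|N] [//|N'] _ /= h x [Jx hx]; split => //.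
exact: le_lt_trans hx.
Qed.

Section ScaledEscapeRate.
Variables (C2 C3 D T : R) (alpha : nat -> R).
Hypotheses (C2_ge0 : 0 <= C2) (C3_gt0 : 0 < C3) (D_ge0 : 0 <= D).
Hypothesis (alpha_ge0 : forall n, 0 <= alpha n).
Hypothesis (alpha0 : alpha n @[n --> \oo] --> 0).
Hypothesis ae_good : {ae m, forall w, good_fibre S C2 C3 D T alpha w}.

Lemma ae_scaled_lam_drop_cvg :
  {ae m, forall w, N%:R * lam_drop S N w @[N --> \oo] --> t w * theta S w}.
Proof.
have ae_orb := ae_biinfinite_orbit ae_good.
have ae_size := ae_hole_size.
have ae_t := S_t_gt0 hS; have ae_xi := S_xi_cvg hS; have ae_q := hC8.
near=> w.
have [good goodV] : (forall n, good_fibre S C2 C3 D T alpha (iter n sg w)) /\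
  (forall n, good_fibre S C2 C3 D T alpha (iter n sgV w)) by near: w.
have tw0 : 0 < t w by near: w.
have xi0 : xi N w @[N --> \oo] --> 0 by near: w.
have size : forall N, (0 < N)%N ->
  mu S w (hole S N w) = ((t w + xi N w) / N%:R)%:E by near: w.
have txi : t w + xi N w @[N --> \oo] --> t w.
  by rewrite -[X in _ --> X]addr0; apply: cvgD => //; exact: cvg_cst.
have txi0 : \forall N \near \oo, 0 < t w + xi N w by exact: (cvgr_gt _ txi).
have mass_pos : \forall N \near \oo, 0 < hole_mass S N w.
  near=> N; have N0 : (0 < N)%N by near: N; exact: nbhs_infty_gt.
  have tx : 0 < t w + xi N w by near: N.
  by rewrite /hole_mass size//= divr_gt0// ltr0n.
(* Holes decrease, so one that is charged at a late index is charged at all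
   earlier ones. *)
have plus : Omega_plus S w.
  move=> N N0; have [K _ hK] := mass_pos.
  have mNK := hK (maxn N K) (leq_maxr _ _).
  apply: (@lt_le_trans _ _ (mu S w (hole S (maxn N K) w))).
    have := mNK; rewrite /hole_mass -lte_fin fineK//.
    exact: (mu_fin_num hclosed hC2 w (measurable_hole hclosed hopen _ w)).
  apply: (le_mu hclosed hC2).
  - exact: (measurable_hole hclosed hopen).
  - exact: (measurable_hole hclosed hopen).
  - by apply: hole_anti; rewrite N0 leq_maxl.
have qcvg : forall k, cvgn (fun N => qhat S N k w).
  by move: plus; near: w.
have ratio := lam_drop_over_hole_mass_cvg hclosed hopen hC2 hC3.1 C2_ge0 C3_gt0 D_ge0
  alpha_ge0 alpha0 good goodV mass_pos qcvg.
have prod : (t w + xi N w) * (lam_drop S N w / hole_mass S N w) @[N --> \oo]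
    --> t w * theta S w by exact: cvgM.
apply: cvg_trans prod; apply: near_eq_cvg.
near=> N.
have N0 : (0 < N)%N by near: N; exact: nbhs_infty_gt.
have tx : 0 < t w + xi N w by near: N.
rewrite /hole_mass size//=; field.
by rewrite pnatr_eq0 -lt0n N0 gt_eqF.
Unshelve. all: by end_near. Qed.

(** The integrand [N lam_drop_N] is cut off at its almost sure bound, so that the
    ergodic theorem applies to functions that are bounded everywhere. *)
Lemma ae_lam_drop_sum_cvg : 0 <= T ->
  {ae m, forall w, \sum_(j < N) lam_drop S N (iter j sg w) @[N --> \oo]
    --> \int[m]_v (t v * theta S v)}.
Proof.
move=> T0; pose K := C2 * C3 * T.
have K0 : 0 <= K by rewrite !mulr_ge0// ltW.
pose G N w := Num.min K (Num.max (- K) (N%:R * lam_drop S N w)).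
have mG N : measurable_fun [set: Om] (G N).
  apply: measurable_minr; first exact: measurable_cst.
  apply: measurable_maxr; first exact: measurable_cst.
  apply: measurable_funM; first exact: measurable_cst.
  exact: measurable_lam_drop.
have GK N w : `|G N w| <= K.
  by rewrite ler_norml /G ge_min lexx le_min le_max lexx /= andbT; lra.
have ae_orb := ae_biinfinite_orbit ae_good.
have GE w N : good_fibre S C2 C3 D T alpha w ->
    good_fibre S C2 C3 D T alpha (sg w) -> G N w = N%:R * lam_drop S N w.
  move=> g0 g1; case: N => [|N].
    by rewrite /G mul0r max_r ?oppr_le0// min_r.
  have := lam_drop_bound hclosed hopen hC2 C2_ge0 C3_gt0 (ltn0Sn N) g0 g1.
  rewrite ler_pdivlMr ?ltr0n// -/K mulrC -[X in X * _](@ger0_norm _ N.+1%:R)//.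
  by rewrite -normrM ler_norml => /andP[h1 h2]; rewrite /G max_r// min_r.
have Gcvg : {ae m, forall w, G N w @[N --> \oo] --> t w * theta S w}.
  apply: filterS2 ae_orb ae_scaled_lam_drop_cvg => w [good _] h.
  rewrite (_ : (fun N => G N w) = (fun N => N%:R * lam_drop S N w))//.
  by apply/funext => N; apply: GE; [exact: (good 0)|exact: (good 1)].
pose g w := limn_sup (G ^~ w).
have mg : measurable_fun [set: Om] g.
  apply: measurable_fun_limn_sup => // w _.
    by exists K => _ [N _ <-]; rewrite (le_trans (ler_norm _)).
  exists (- K) => _ [N _ <-].
  by have := GK N w; rewrite ler_norml => /andP[].
have gE : {ae m, forall w, g w = t w * theta S w}.
  by apply: filterS Gcvg => w /cvg_limn_inf_sup[_ <-].
have Gg : {ae m, forall w, G N w @[N --> \oo] --> g w}.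
  by apply: filterS2 Gcvg gE => w h ->.
have intE : \int[m]_w g w = \int[m]_v (t v * theta S v).
  by congr fine; apply: ae_eq_integral_any; apply: filterS gE => w ->.
have birk := varying_birkhoff (measurable_sigma hclosed) (sigma_preserving hclosed)
  (sigma_ergodic hclosed) mG mg GK Gg.
apply: filterS2 ae_orb birk => w [good _]; rewrite intE => h.
apply: cvg_trans h; apply: near_eq_cvg; near=> N.
have N0 : (0 < N)%N by near: N; exact: nbhs_infty_gt.
rewrite /birkhoff_sum mulr_sumr; apply: eq_bigr => j _.
rewrite GE ?mulKf ?pnatr_eq0 -?lt0n//.
exact: (good j.+1).
Unshelve. all: by end_near. Qed.

End ScaledEscapeRate.

End AlmostEveryFibre.

Theorem corollary9 (R : realType) (d : measure_display) (Om : measurableType d)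
    (m : probability Om R) (X : completePseudoMetricType R)
    (hX : hausdorff_space X) (S : random_system Om X)
    (hclosed : closed_system m S) (hopen : open_system m S)
    (hC1 : cond_C1 m S) (hC2 : cond_C2 m S) (hC3 : cond_C3 m S)
    (hC4 : cond_C4 m S) (hC5 : cond_C5 m S) (hC7 : cond_C7 m S)
    (hC8 : cond_C8 m S)
    (t : Om -> R) (xi : nat -> Om -> R) (W : R) (hS : cond_S m S t xi W) :
  {ae m, forall w : Om,
    mu S w [set x | fib S w x /\
              ((t w)%:E < hitting_time S N w x * mu S w (hole S N w))%E]
      @[N --> \oo]
      --> (expR (- \int[m]_v (t v * theta S v)))%:E}.
Proof.
have [C2 [C3 [D [T [alpha [[C20 C30 D0 T0] al0 alc aeg]]]]]] :=
  ae_good_fibre hclosed hopen hC2 hC3 hS hC4 hC5 hC7.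
have ae_orb := ae_biinfinite_orbit hclosed aeg.
have ae_sum := ae_lam_drop_sum_cvg hclosed hopen hC2 hC3 hC8 hS C20 C30 D0 al0 alc aeg T0.
have ae_size := ae_hole_size hS.
have ae_t := S_t_gt0 hS; have ae_xi := S_xi_cvg hS.
near=> w.
have [good _] : (forall n, good_fibre S C2 C3 D T alpha (iter n (sigma S) w)) /\
  (forall n, good_fibre S C2 C3 D T alpha (iter n (sigma_inv S) w)) by near: w.
apply: (hitting_law hclosed hopen hC2 hC3.1 C20 C30 alc good (xi := xi ^~ w)).
- by near: w.
- by near: w.
- by near: w.
- by near: w.
Unshelve. all: by end_near. Qed.
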